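(* Let $n\ge1$ be an integer and define $\langle f,g\rangle_{\triangle^\circ,n}=\frac6{n^3}\sum_{\mathbf j\in\Lambda_n^\circ}f(\tfrac{\mathbf j}{4n})\overline{g(\tfrac{\mathbf j}{4n})}$. Then $$\langle f,g\rangle_{\triangle^\circ,n}=\langle f,g\rangle_{\triangle_H}\qquad\text{for all } f,g\in\mathcal{TS}_n .$$
   Context: Let $\mathbb R^4_H=\{\mathbf t\in\mathbb R^4: t_1+t_2+t_3+t_4=0\}$ with 3-dimensional Lebesgue measure $d\mathbf t$, $\mathbb Z^4_H=\mathbb Z^4\cap\mathbb R^4_H$, $\mathbb H=\{\mathbf k\in\mathbb Z^4_H: k_1\equiv k_2\equiv k_3\equiv k_4\pmod4\}$, $\phi_{\mathbf k}(\mathbf t)=e^{\frac{\pi i}{2}\mathbf k\cdot\mathbf t}$. Let $\mathcal G=S_4$ act on $\mathbf t$ by permuting coordinates, $\mathbf t\mapsto\mathbf t\sigma$, and let $\operatorname{sgn}\sigma$ be the sign of $\sigma$. Define $\mathsf{TS}_{\mathbf k}(\mathbf t)=-\frac1{24}\sum_{\sigma\in\mathcal G}\operatorname{sgn}(\sigma)\phi_{\mathbf k}(\mathbf t\sigma)$. Let $\triangle_H=\{\mathbf t\in\mathbb R^4_H: t_1-t_2,\,t_2-t_3,\,t_3-t_4,\,t_1-t_4\in[0,1]\}$ and $\langle f,g\rangle_{\triangle_H}=\frac1{|\triangle_H|}\int_{\triangle_H}f\bar g\,d\mathbf t$. Let $\Lambda_n^\circ=\{\mathbf k\in\mathbb H: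 k_4<k_3<k_2<k_1<k_4+4n\}$ and $\mathcal{TS}_n=\operatorname{span}\{\mathsf{TS}_{\mathbf k}:\mathbf k\in\Lambda_n^\circ\}$. *)

(* Defs.v *)
From HB Require Import structures.
From mathcomp Require Import all_boot all_order all_algebra all_fingroup.
From mathcomp Require Import all_classical all_reals all_analysis.
From mathcomp.real_closed Require Import complex.

Set Implicit Arguments.
Unset Strict Implicit.
Unset Printing Implicit Defensive.

Import Order.TTheory GRing.Theory Num.Theory.
Local Open Scope ring_scope.

Section Defs.
Variable R : realType.

Definition pt4 := 'I_4 -> R.
Definition ivec := 'I_4 -> int.

Definition o1 : 'I_4 := @Ordinal 4 0 isT.
Definition o2 : 'I_4 := @Ordinal 4 1 isT.
Definition o3 : 'I_4 := @Ordinal 4 2 isT.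
Definition o4 : 'I_4 := @Ordinal 4 3 isT.

Definition dotk (k : ivec) (t : pt4) : R := \sum_(i < 4) (k i)%:~R * t i.

Definition expi (x : R) : R[i] := Complex (cos x) (sin x).

Definition phi (k : ivec) (t : pt4) : R[i] := expi (pi / 2 * dotk k t).

Definition permpt (t : pt4) (s : 'S_4) : pt4 := fun i => t (s i).

Definition TS (k : ivec) (t : pt4) : R[i] :=
  - (24%:R)^-1 * \sum_(s : 'S_4) (-1) ^+ (odd_perm s) * phi k (permpt t s).

Definition inH (k : ivec) : bool :=
  [&& (\sum_(i < 4) k i == 0),
      (4 %| k o1 - k o2)%Z, (4 %| k o2 - k o3)%Z & (4 %| k o3 - k o4)%Z].

Definition inLambda (n : nat) (k : ivec) : bool :=
  [&& inH k, k o4 < k o3, k o3 < k o2, k o2 < k o1 & k o1 < k o4 + (4 * n)%:Z].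

Definition inTSn (n : nat) (f : pt4 -> R[i]) : Prop :=
  exists s : seq (R[i] * ivec),
    all (fun p => inLambda n p.2) s /\
    f = (fun t => \sum_(p <- s) p.1 * TS p.2 t).

(* Enumeration of Lambda_n^o: every k in Lambda_n^o has all entries in
   (-4n, 4n); we enumerate the box [-4n, 4n]^4 via j |-> j - 4n. *)
Definition boxvec (n : nat) (j : {ffun 'I_4 -> 'I_(8 * n + 1)}) : ivec :=
  fun i => (j i)%:Z - (4 * n)%:Z.

Definition disc_ip (n : nat) (f g : pt4 -> R[i]) : R[i] :=
  (6%:R / (n%:R ^+ 3)) *
  \sum_(j : {ffun 'I_4 -> 'I_(8 * n + 1)} | inLambda n (boxvec j))
     f (fun i => (boxvec j i)%:~R / (4 * n)%:R) *
     (g (fun i => (boxvec j i)%:~R / (4 * n)%:R))^*.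

Definition embH (p : (R * R) * R) : pt4 :=
  fun i => match val i with
           | 0 => p.1.1 | 1 => p.1.2 | 2 => p.2 | _ => - (p.1.1 + p.1.2 + p.2)
           end.

Definition triH : set ((R * R) * R) :=
  [set p | let t := embH p in
     [/\ 0 <= t o1 - t o2 <= 1, 0 <= t o2 - t o3 <= 1,
         0 <= t o3 - t o4 <= 1 & 0 <= t o1 - t o4 <= 1]].

Definition leb3 := ((@lebesgue_measure R \x @lebesgue_measure R) \x
                     @lebesgue_measure R)%E.

(* <f,g>_{triangle_H} = 1/|triangle_H| int_{triangle_H} f conj(g) dt.
   The 3-dim Lebesgue (Hausdorff) measure on R^4_H is a constant multiple
   (namely 2) of the pushforward of leb3 under embH, so the normalized
   inner product can be computed in parameter coordinates. *)
Definition cont_ip (f g : pt4 -> R[i]) : R[i] :=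
  let h := fun p => f (embH p) * (g (embH p))^* in
  let vol := Rintegral leb3 triH (fun _ => 1) in
  (Complex (Rintegral leb3 triH (fun p => complex.Re (h p)))
           (Rintegral leb3 triH (fun p => complex.Im (h p)))) / Complex vol 0.

End Defs.

(* Main.v *)
(* The permutations of the coordinates and the translations by integer vectors
   of zero sum generate an affine Weyl group W, of which the triangle is a
   fundamental domain, while the unit cube in the coordinates (t1, t2, t3) is a
   fundamental domain for its translations.  If f and g are in the span of the
   TS_k, then f g^* is W-invariant and vanishes on the walls t_i - t_j in Z, so
   that, for Lebesgue measure as well as for counting measure on the lattice
   H/4n, its integral over the cube is 24 times its integral over the open
   triangle.  Both integrals over the cube are computed on exponentials: f g^*
   is a combination of phi_m with m = k.s - l.u for k, l in Lambda_n, such a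
   phi_m has integral 0 on the cube unless m = 0, and has sum 0 over the lattice
   points of the cube unless 4n divides all the m_i; in that case m = 4n q with
   q of zero sum and pairwise differences at most 1, whence again m = 0. *)
Require Import Defs.
From HB Require Import structures.
From mathcomp Require Import all_boot all_order all_algebra all_fingroup.
From mathcomp Require Import all_classical all_reals all_analysis.
From mathcomp Require Import measurable_realfun.
From mathcomp.real_closed Require Import complex.
From mathcomp Require Import ring lra zify.
Import Order.TTheory GRing.Theory Num.Theory.
Import numFieldNormedType.Exports.
Local Open Scope ring_scope.
Local Open Scope classical_set_scope.

Set Implicit Arguments.
Unset Strict Implicit.
Unset Printing Implicit Defensive.

(** * The alcove and its translates *)

Section Combinatorics.
Variable R : realType.
Local Notation T3 := ((R * R) * R)%type.

Lemma ord4P (P : 'I_4 -> Prop) : P o1 -> P o2 -> P o3 -> P o4 -> forall i, P i.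
Proof.
move=> h1 h2 h3 h4 [[|[|[|[|//]]]] hi].
- by have -> : Ordinal hi = o1 by apply: val_inj.
- by have -> : Ordinal hi = o2 by apply: val_inj.
- by have -> : Ordinal hi = o3 by apply: val_inj.
- by have -> : Ordinal hi = o4 by apply: val_inj.
Qed.

Lemma sum4E (V : nmodType) (F : 'I_4 -> V) :
  \sum_(i < 4) F i = F o1 + F o2 + F o3 + F o4.
Proof.
rewrite !big_ord_recr big_ord0 /= add0r.
by congr (F _ + F _ + F _ + F _); apply: val_inj.
Qed.

Definition projH (t : pt4 R) : T3 := (t o1, t o2, t o3).

Lemma projHK (p : T3) : projH (embH p) = p.
Proof. by case: p => [[a b] c]. Qed.

Lemma embH_sum (p : T3) : \sum_(i < 4) embH p i = 0.
Proof. by rewrite sum4E /embH /=; ring. Qed.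

Lemma embHK (t : pt4 R) : \sum_(i < 4) t i = 0 -> embH (projH t) = t.
Proof.
rewrite sum4E => ht; apply/funext; apply: ord4P; rewrite /embH //=.
by apply/eqP; rewrite eq_sym -addr_eq0 addrC ht.
Qed.

Lemma embHD (p q : T3) i : embH (p + q) i = embH p i + embH q i.
Proof. by move: i; apply: ord4P; rewrite /embH /=; ring. Qed.

Lemma embHN (p : T3) i : embH (- p) i = - embH p i.
Proof. by move: i; apply: ord4P; rewrite /embH /=; ring. Qed.

(** The coordinate permutations read in the chart of the first three coordinates, where those that
    move the fourth one become linear maps. *)
Definition actS (s : 'S_4) (p : T3) : T3 := projH (permpt (embH p) s).

Lemma embH_act s p : embH (actS s p) = permpt (embH p) s.
Proof.
apply: embHK; transitivity (\sum_(i < 4) embH p i); last exact: embH_sum.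
by rewrite [RHS](reindex_inj (@perm_inj _ s)).
Qed.

Lemma actSM s s' p : actS s (actS s' p) = actS (s * s')%g p.
Proof.
rewrite /actS embH_act; congr projH; apply/funext => i.
by rewrite /permpt permM.
Qed.

(** Bits suffice to translate between cube and cell: the first three coordinates lie in (-1, 1) on
    the cell and in [0, 1) on the cube. *)
Definition natvec (b : bool * bool * bool) : T3 :=
  (b.1.1%:R, b.1.2%:R, b.2%:R).

Definition cubeQ : set T3 :=
  [set p | [/\ 0 <= p.1.1 < 1, 0 <= p.1.2 < 1 & 0 <= p.2 < 1]].
(** Intermediate between cube and alcove: up to the walls a fundamental domain of the translations,
    like the cube, but stable under permutations, so that sorting cuts it into 24 copies of the
    alcove. *)
Definition cell : set T3 :=
  [set p | forall i j, embH p i - embH p j < 1].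
Definition simplex0 : set T3 := [set p | let t := embH p in
  [/\ t o2 < t o1, t o3 < t o2, t o4 < t o3 & t o1 < t o4 + 1]].
(** The reflection hyperplanes of the affine Weyl group. *)
Definition walls : set T3 :=
  [set p | exists i j, i != j /\ exists z : int, embH p i - embH p j = z%:~R].

Lemma sorting_perm n (f : 'I_n -> R) :
  exists s : 'S_n, forall i j : 'I_n, (i <= j)%N -> f (s j) <= f (s i).
Proof.
set t := [tuple f i | i < n].
have /tuple_permP[s hs] : perm_eq (sort >=%R t) t by rewrite perm_sort.
exists s => i j ij.
have sz : size (sort >=%R t) = n by rewrite size_sort size_tuple.
have nthE (k : 'I_n) : nth 0 (sort >=%R t) k = f (s k).
  by rewrite hs -tnth_nth !tnth_mktuple.
rewrite -!nthE; apply: (@sorted_leq_nth _ >=%R) => //.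
- by move=> x y z /= xy yz; exact: le_trans yz xy.
- by move=> x /=.
- by apply: sort_sorted => x y; exact: le_total.
- by rewrite inE sz.
- by rewrite inE sz.
Qed.

(** Strict decrease makes [f] injective; both orderings list the values of [f] in strictly
    decreasing order, and there is only one such list. *)
Lemma sorting_perm_uniq n (f : 'I_n -> R) (s s' : 'S_n) :
  (forall i j : 'I_n, (i < j)%N -> f (s j) < f (s i)) ->
  (forall i j : 'I_n, (i < j)%N -> f (s' j) < f (s' i)) -> s = s'.
Proof.
move=> hs hs'.
have sortedE (u : 'S_n) : (forall i j : 'I_n, (i < j)%N -> f (u j) < f (u i)) ->
    sorted >%R [seq f (u i) | i <- enum 'I_n].
  move=> hu; apply: (@homo_sorted _ _ (fun i => f (u i)) (relpre (val : 'I_n -> nat) ltn)).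
    by move=> i j /= /hu.
  by rewrite -sorted_map val_enum_ord iota_ltn_sorted.
have inj : injective f.
  move=> x y fxy; rewrite -(permKV s x) -(permKV s y); congr (s _).
  have := congr1 id fxy; rewrite -{1}(permKV s x) -{1}(permKV s y).
  case: (ltngtP ((s^-1)%g x) ((s^-1)%g y)) => [/hs|/hs|/val_inj //] h e.
  - by move: h; rewrite e ltxx.
  - by move: h; rewrite e ltxx.
have mapE : [seq f (s i) | i <- enum 'I_n] = [seq f (s' i) | i <- enum 'I_n].
  apply: (@irr_sorted_eq _ >%R); [|by move=> x /=; rewrite ltxx|exact: sortedE..|].
    by move=> x y z /= xy yz; exact: lt_trans yz xy.
  have memE (u : 'S_n) : [seq f (u i) | i <- enum 'I_n] =i codom f.
    move=> y; apply/mapP/codomP => [[i _ ->]|[x ->]]; first by exists (u i).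
    by exists ((u^-1)%g x); rewrite ?mem_enum // permKV.
  by move=> y; rewrite !memE.
by apply/permP => i; apply: inj; have /eq_in_map := mapE; apply; rewrite mem_enum.
Qed.

(** By the zero sum, 4 t_i is the sum of the differences t_i - t_j, three of which are nontrivial;
    hence it is below 3 in absolute value. *)
Lemma cell_coord p i : cell p -> -1 < embH p i < 1.
Proof.
move=> hp; have := embH_sum p; rewrite sum4E => h0.
have := hp i o1; have := hp i o2; have := hp i o3; have := hp i o4.
have := hp o1 i; have := hp o2 i; have := hp o3 i; have := hp o4 i.
by move: (embH p i) => x; lra.
Qed.

Lemma int_lt_1 (z : int) : (z%:~R : R) < 2%:R -> z <= 1.
Proof. by rewrite (_ : 2%:R = (2 : int)%:~R) // ltr_int; lia. Qed.

(** A positive entry would force all entries to be nonnegative, against the zero sum. This separates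
    the translates of the cell, and later excludes aliasing of nonzero frequencies. *)
Lemma int4_eq0 (m : 'I_4 -> int) :
  \sum_(i < 4) m i = 0 -> (forall i j, m i - m j <= 1) -> forall i, m i = 0.
Proof.
rewrite sum4E => h0 hm.
have := (hm o1 o2, hm o1 o3, hm o1 o4, hm o2 o1, hm o2 o3, hm o2 o4).
have := (hm o3 o1, hm o3 o2, hm o3 o4, hm o4 o1, hm o4 o2, hm o4 o3).
move=> [[[[[? ?] ?] ?] ?] ?] [[[[[? ?] ?] ?] ?] ?].
by apply: ord4P; lia.
Qed.

(** The two translations differ by an integer vector of zero sum whose entries differ by less than
    2, hence by at most 1. *)
Lemma cell_shift_uniq p b b' :
  cell (p - natvec b) -> cell (p - natvec b') -> b = b'.
Proof.
move=> hb hb'.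
pose c (b : bool * bool * bool) : 'I_4 -> int := fun i => match val i with
  | 0 => b.1.1%:Z | 1 => b.1.2%:Z | 2 => b.2%:Z
  | _ => - (b.1.1%:Z + b.1.2%:Z + b.2%:Z) end.
have cE (d : bool * bool * bool) i : embH (natvec d) i = (c d i)%:~R.
  by move: i; apply: ord4P; rewrite /embH /c /= ?rmorphN ?rmorphD.
have h0 : forall i, c b i - c b' i = 0.
  apply: int4_eq0.
    by rewrite sum4E /c /=; ring.
  move=> i j; apply: int_lt_1.
  have := hb j i; have := hb' i j; rewrite !embHD !embHN !cE.
  by rewrite !(rmorphB, rmorphD, rmorphN) /=; lra.
have := h0 o1; have := h0 o2; have := h0 o3; rewrite /c /=.
by case: b {hb h0} => [[[] []] []]; case: b' {hb'} => [[[] []] []].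
Qed.

Lemma cell_cubeQ p : cell p -> exists b, cubeQ (p + natvec b).
Proof.
(* Negative coordinates exceed -1, so adding 1 to exactly these lands in the cube. *)
move=> hp; exists (p.1.1 < 0, p.1.2 < 0, p.2 < 0).
have := cell_coord o1 hp; have := cell_coord o2 hp.
have := cell_coord o3 hp; rewrite /embH /cubeQ /= => h3 h2 h1.
by split; (case: ltP => h; rewrite ?mulr1n ?mulr0n; lra).
Qed.

Lemma cubeQ_shift_uniq p b b' :
  cubeQ (p + natvec b) -> cubeQ (p + natvec b') -> b = b'.
Proof.
case: b => [[b1 b2] b3]; case: b' => [[b1' b2'] b3'].
rewrite /cubeQ /= => -[h1 h2 h3] [h1' h2' h3'].
have aux (x : R) (c c' : bool) :
    0 <= x + c%:R < 1 -> 0 <= x + c'%:R < 1 -> c = c'.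
  by case: c; case: c' => //; rewrite ?mulr1n ?mulr0n; lra.
by rewrite (aux _ _ _ h1 h1') (aux _ _ _ h2 h2') (aux _ _ _ h3 h3').
Qed.

(* Reduce the fourth coordinate mod 1 as well: the coordinates then lie in
   [0,1) and sum to some q in {0,..,3}; subtracting 1 from the q largest ones
   restores the zero sum while keeping all differences below 1. *)
Lemma cell_cover p : cubeQ p -> ~ walls p -> exists b, cell (p - natvec b).
Proof.
have aux (w : int) : w <= 0 -> -4 < w -> exists2 q : nat, (q <= 4)%N & w = - q%:Z.
  by move=> w0 w4; exists `|w|%N; lia.
move=> [hp1 hp2 hp3] hN.
pose z := Num.floor (embH p o4).
pose r (i : 'I_4) : R := embH p i - (if i == o4 then z else 0)%:~R.
have hz4 : z%:~R <= embH p o4 < (z + 1)%:~R by exact: floor_itv.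
rewrite rmorphD /= in hz4.
have hr i : 0 <= r i < 1.
  by move: i; apply: ord4P; rewrite /r /= ?subr0 //; lra.
have [q hq4 hq] : exists2 q : nat, (q <= 4)%N & z = - q%:Z.
  have h4 : -3 < embH p o4 <= 0 by rewrite /embH /=; lra.
  have z0 : z <= 0 by rewrite -(ler_int R); lra.
  have z4 : (-4 < z) by rewrite -(ltr_int R) rmorphN /=; lra.
  exact: aux.
have [s hs] := @sorting_perm 4 r.
pose c (i : 'I_4) : bool := ((s^-1)%g i < q)%N.
have cq : (\sum_(i < 4) c i = q)%N.
  rewrite (reindex_inj (@perm_inj _ s)) /= (eq_bigr (fun i : 'I_4 => (i < q)%N : nat)).
    by rewrite sum4E /=; case: q hq4 {hq c} => [|[|[|[|[|]]]]].
  by move=> i _; rewrite /c permK.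
exists (c o1, c o2, c o3).
have yE i : embH (p - natvec (c o1, c o2, c o3)) i = r i - (c i)%:R.
  move: i; apply: ord4P; rewrite embHD embHN /r /= ?subr0 //.
  have := congr1 (fun n : nat => n%:R : R) cq.
  rewrite sum4E !natrD hq rmorphN /= -pmulrn => <-; rewrite /embH /=; ring.
move=> i j; rewrite !yE.
have := hr i; have := hr j; rewrite /c.
case: (ltnP ((s^-1)%g i) q) => hi; case: (ltnP ((s^-1)%g j) q) => hj;
  rewrite ?mulr1n ?mulr0n; try lra.
(* Remaining case: [j] is lowered by 1 and [i] is not, so that r i < r j must be strict; equality
   would put [p] on a wall. *)
have := hs _ _ (ltnW (leq_trans hj hi)); rewrite !permKV.
rewrite le_eqVlt => /predU1P[rij _ _|]; last by lra.
case: hN; exists i, j; split.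
  by apply: contraTneq hj => <-; rewrite -leqNgt.
exists ((if i == o4 then z else 0) - (if j == o4 then z else 0)).
by rewrite rmorphB /=; move: rij; rewrite /r; lra.
Qed.

Lemma simplex0_cover p : cell p -> ~ walls p -> exists s, simplex0 (actS s p).
Proof.
move=> hp hN; have [s hs] := @sorting_perm 4 (embH p); exists s.
rewrite /simplex0 /= embH_act /permpt.
have lt_s (i j : 'I_4) : (i < j)%N -> embH p (s j) < embH p (s i).
  move=> ij; rewrite lt_neqAle (hs i j (ltnW ij)) andbT; apply/negP => /eqP e.
  apply: hN; exists (s j), (s i); split; last by exists 0; rewrite e subrr.
  by rewrite (inj_eq perm_inj); apply: contraTneq ij => ->; rewrite ltnn.
split; [exact: lt_s..|].
by have := hp (s o1) (s o4); lra.
Qed.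

Lemma simplex0_uniq p s s' :
  simplex0 (actS s p) -> simplex0 (actS s' p) -> s = s'.
Proof.
rewrite /simplex0 /= !embH_act /permpt => -[h1 h2 h3 _] [h1' h2' h3' _].
by apply: (@sorting_perm_uniq _ (embH p)); apply: ord4P; apply: ord4P => //= _; lra.
Qed.

Lemma simplex0_cell s p : simplex0 (actS s p) -> cell p.
Proof.
rewrite /simplex0 /= embH_act /permpt => -[h1 h2 h3 h4] i j.
rewrite -(permKV s i) -(permKV s j).
by move: (s^-1%g i) (s^-1%g j); apply: ord4P; apply: ord4P; lra.
Qed.

Lemma simplex0_sub_cell : simplex0 `<=` cell.
Proof.
move=> p hp; apply: (@simplex0_cell 1%g).
rewrite /actS (_ : permpt _ _ = embH p) ?projHK //.
by apply/funext => i; rewrite /permpt perm1.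
Qed.

End Combinatorics.

(** * Folding the unit cube onto the open alcove *)

Section Folding.
Context {R : realType}.
Local Notation T3 := ((R * R) * R)%type.

(** A bounded region containing every domain in use: on it bounded functions are integrable and
    lattice sums are finite. *)
Definition box : set T3 :=
  [set p | [/\ -1 <= p.1.1 <= 1, -1 <= p.1.2 <= 1 & -1 <= p.2 <= 1]].

Definition boxm (A : set T3) := measurable A /\ A `<=` box.

Lemma measurable_coord i : measurable_fun [set: T3] (fun p => embH p i).
Proof.
move: i; apply: ord4P; rewrite /embH /=.
- exact: (measurableT_comp measurable_fst measurable_fst).
- exact: (measurableT_comp measurable_snd measurable_fst).
- exact: measurable_snd.
- apply: measurableT_comp => //; apply: measurable_funD.
    apply: measurable_funD.
      exact: (measurableT_comp measurable_fst measurable_fst).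
    exact: (measurableT_comp measurable_snd measurable_fst).
  exact: measurable_snd.
Qed.

Lemma measurable_ltr (f g : T3 -> R) : measurable_fun setT f ->
  measurable_fun setT g -> measurable [set p | f p < g p].
Proof.
move=> mf mg; rewrite -[X in measurable X]setTI.
have /(_ measurableT [set true] I) := measurable_fun_ltr mf mg; exact.
Qed.

Lemma measurable_ler (f g : T3 -> R) : measurable_fun setT f ->
  measurable_fun setT g -> measurable [set p | f p <= g p].
Proof.
move=> mf mg; rewrite -[X in measurable X]setTI.
have /(_ measurableT [set true] I) := measurable_fun_ler mf mg; exact.
Qed.

Lemma measurable_cell : measurable (@cell R).
Proof.
rewrite (_ : @cell R  = \bigcap_(i in [set: 'I_4]) \bigcap_(j in [set: 'I_4])
    [set p | embH p i - embH p j < 1]).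
  apply: fin_bigcap_measurable => // i _; apply: fin_bigcap_measurable => // j _.
  by apply: measurable_ltr => //; apply: measurable_funB; exact: measurable_coord.
by apply/seteqP; split => p hp i; [move=> _ j _; exact: hp|move=> j; exact: hp].
Qed.

Lemma measurable_cubeQ : measurable (@cubeQ R).
Proof.
rewrite (_ : @cubeQ R  = (`[0, 1[ `*` `[0, 1[) `*` `[0, 1[).
  by apply: measurableX => //; apply: measurableX.
apply/seteqP; split => -[[x y] z] /=; rewrite /cubeQ /= !in_itv /=.
  by move=> [].
by move=> [[]].
Qed.

Lemma measurable_simplex0 : measurable (@simplex0 R).
Proof.
rewrite (_ : @simplex0 R  = [set p | embH p o2 < embH p o1] `&`
  [set p | embH p o3 < embH p o2] `&` [set p | embH p o4 < embH p o3] `&`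
  [set p | embH p o1 < embH p o4 + 1]).
  repeat apply: measurableI; apply: measurable_ltr; try exact: measurable_coord.
  by apply: measurable_funD => //; exact: measurable_coord.
by apply/seteqP; split => p /= => [[]|[[[]]]].
Qed.

Lemma measurable_proj (U : T3 -> pt4 R) :
  (forall i, measurable_fun setT (fun p => U p i)) ->
  measurable_fun setT (fun p => projH (U p)).
Proof.
by move=> mU; apply: measurable_fun_pair => //; apply: measurable_fun_pair.
Qed.

Lemma measurable_actS s : measurable_fun setT (@actS R s).
Proof. by apply: measurable_proj => i; exact: measurable_coord. Qed.

Lemma measurable_shift (v : T3) : measurable_fun setT (fun p : T3 => p + v).
Proof.
rewrite (_ : (fun p => _) = fun p => projH (fun i => embH p i + embH v i)).
  apply: measurable_proj => i; apply: measurable_funD => //.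
  exact: measurable_coord.
by apply/funext => -[[x y] z]; case: v => -[].
Qed.

Lemma preimage_measurable (T : T3 -> T3) A :
  measurable_fun setT T -> measurable A -> measurable (T @^-1` A).
Proof. by move=> mT mA; rewrite -[X in measurable X]setTI; exact: mT. Qed.

Lemma cubeQ_box : @cubeQ R `<=` box.
Proof. by move=> p [h1 h2 h3]; split; lra. Qed.

Lemma cell_box : @cell R `<=` box.
Proof.
move=> p hp; have := cell_coord o1 hp; have := cell_coord o2 hp.
by have := cell_coord o3 hp; rewrite /embH /= => h1 h2 h3; split; lra.
Qed.

Lemma boxm_cubeQ : boxm (@cubeQ R).
Proof. by split; [exact: measurable_cubeQ|exact: cubeQ_box]. Qed.

Lemma boxm_cell : boxm (@cell R).
Proof. by split; [exact: measurable_cell|exact: cell_box]. Qed.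

Lemma boxm_simplex0 : boxm (@simplex0 R).
Proof.
by split; [exact: measurable_simplex0|move=> p /simplex0_sub_cell/cell_box].
Qed.

(* [mu A] stands for the integral over [A], with respect to Lebesgue measure
   or to a lattice, of a function invariant under the affine Weyl group. *)
Variables (V : zmodType) (mu : set T3 -> V).
Hypothesis muU : forall A B, boxm A -> boxm B -> A `&` B = set0 ->
  mu (A `|` B) = mu A + mu B.
Hypothesis mu_walls : forall A, boxm A -> A `<=` @walls R -> mu A = 0.
Hypothesis mu_shift : forall (b : bool * bool * bool) A, boxm A ->
  boxm ((fun p => p + natvec R b) @^-1` A) ->
  mu ((fun p => p + natvec R b) @^-1` A) = mu A.
Hypothesis mu_act : forall (s : 'S_4) A, boxm A -> boxm (actS s @^-1` A) ->
  mu (actS s @^-1` A) = mu A.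

Lemma boxmI A B : boxm A -> measurable B -> boxm (A `&` B).
Proof. by move=> [mA bA] mB; split; [exact: measurableI|move=> p [/bA]]. Qed.

(** Finite additivity cuts [B] along one [A i] at a time; what is left after the last cut lies in
    the walls, where [mu] vanishes. *)
Lemma mu_partition (I : eqType) (r : seq I) (A : I -> set T3) B :
  uniq r -> boxm B -> (forall i, measurable (A i)) ->
  (forall p, B p -> forall i j, A i p -> A j p -> i = j) ->
  (forall p, B p -> ~ @walls R p -> exists2 i, i \in r & A i p) ->
  mu B = \sum_(i <- r) mu (B `&` A i).
Proof.
elim: r B => [|i r IH] B /=.
  move=> _ hB _ _ cov; rewrite big_nil; apply: mu_walls => // p Bp.
  by apply: contrapT => /(cov _ Bp)[].
move=> /andP[ir ur] hB mA disj cov; rewrite big_cons.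
have hBi : boxm (B `&` A i) by exact: boxmI.
have hBC : boxm (B `&` ~` A i) by apply: boxmI => //; exact: measurableC.
rewrite -{1}(setIT B) -(setUv (A i)) setIUr muU //; last first.
  by rewrite setIACA setICr setI0.
congr (_ + _); rewrite (IH (B `&` ~` A i)) //.
- apply: eq_big_seq => j jr; congr (mu _).
  apply/seteqP; split => p /=; first by move=> [[]].
  move=> [Bp Ajp]; split => //; split => // Aip.
  by move: ir; rewrite (disj p Bp i j) // jr.
- by move=> p [Bp _]; exact: disj.
- move=> p [Bp nAp] /(cov _ Bp)[j]; rewrite inE => /predU1P[->//|jr Ajp].
  by exists j.
Qed.

Lemma folding : mu (@cubeQ R) = mu (@simplex0 R) *+ 24.
Proof.
have hQ := boxm_cubeQ; have hP := boxm_cell; have hD := boxm_simplex0.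
(* Cube and cell are cut into the eight pieces where cube meets cell + b, resp. cell meets cube - b;
   the translation by b matches these pieces one to one. *)
transitivity (mu (@cell R)).
  rewrite (@mu_partition _ (index_enum (bool * bool * bool)%type)
    (fun b => (fun p => p - natvec R b) @^-1` @cell R) (@cubeQ R)) //; first last.
  - move=> p Qp /(cell_cover Qp)[b Pb]; exists b => //; exact: mem_index_enum.
  - by move=> p Qp b b'; exact: cell_shift_uniq.
  - move=> b; apply: preimage_measurable; last exact: measurable_cell.
    exact: measurable_shift.
  - exact: index_enum_uniq.
  rewrite (@mu_partition _ (index_enum (bool * bool * bool)%type)
    (fun b => (fun p => p + natvec R b) @^-1` @cubeQ R) (@cell R)) //; first last.
  - move=> p Pp _; have [b Qb] := cell_cubeQ Pp; exists b => //; exact: mem_index_enum.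
  - by move=> p Pp b b'; exact: cubeQ_shift_uniq.
  - move=> b; apply: preimage_measurable; last exact: measurable_cubeQ.
    exact: measurable_shift.
  - exact: index_enum_uniq.
  apply: eq_bigr => b _.
  have e : (fun p => p + natvec R b) @^-1`
      (@cubeQ R `&` (fun p => p - natvec R b) @^-1` @cell R) =
      @cell R `&` (fun p => p + natvec R b) @^-1` @cubeQ R.
    by apply/seteqP; split => p /=; rewrite addrK => -[].
  rewrite -e mu_shift //; [|rewrite e]; apply: boxmI => //;
    apply: preimage_measurable;
    (exact: measurable_shift || exact: measurable_cell || exact: measurable_cubeQ).
(* The cell is cut according to the permutation that sorts the coordinates; each piece has the
   measure of the alcove. *)
rewrite (@mu_partition _ (index_enum 'S_4) (fun s => actS s @^-1` @simplex0 R) (@cell R)) //;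
  first last.
- move=> p Pp /(simplex0_cover Pp)[s Ds]; exists s => //; exact: mem_index_enum.
- by move=> p _ s s'; exact: simplex0_uniq.
- by move=> s; apply: preimage_measurable; [exact: measurable_actS|exact: measurable_simplex0].
- exact: index_enum_uniq.
rewrite (eq_bigr (fun=> mu (@simplex0 R))) => [|s _].
  by rewrite sumr_const card_Sn.
rewrite (_ : @cell R `&` _ = actS s @^-1` @simplex0 R).
  apply: mu_act => //; split.
    by apply: preimage_measurable; [exact: measurable_actS|exact: measurable_simplex0].
  by move=> p /simplex0_cell/cell_box.
by apply/seteqP; split => p /= => [[]|h] //; split => //; exact: simplex0_cell h.
Qed.

End Folding.

(** * Invariance of Lebesgue measure *)

Section MeasurePreserving.

Definition measure_preserving d (T : measurableType d) (R : realType) (m : set T -> \bar R)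
    (f : T -> T) :=
  measurable_fun setT f /\ forall A, measurable A -> m (f @^-1` A) = m A.

Lemma measure_preserving_comp d (T : measurableType d) (R : realType) (m : set T -> \bar R) f g :
  measure_preserving m f -> measure_preserving m g -> measure_preserving m (f \o g).
Proof.
move=> [mf hf] [mg hg]; split; first exact: measurableT_comp.
move=> A mA; rewrite comp_preimage hg ?hf //.
by rewrite -[X in measurable X]setTI; exact: mf.
Qed.

Lemma measure_preserving_integral d (T : measurableType d) (R : realType)
    (m : {measure set T -> \bar R}) (h : T -> T) (f : T -> \bar R) A :
  measure_preserving m h -> measurable_fun setT f -> f \o h = f -> measurable A ->
  m.-integrable (h @^-1` A) f ->
  (\int[m]_(x in h @^-1` A) f x = \int[m]_(x in A) f x)%E.
Proof.
move=> [mh hm] mf fh mA intf.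
transitivity (\int[pushforward m h]_(x in A) f x)%E; last first.
  apply: eq_measure_integral => B mB _; exact: hm.
by rewrite integral_pushforward ?fh.
Qed.

Context d1 d2 (T1 : measurableType d1) (T2 : measurableType d2) (R : realType).
Variables (m1 : {sigma_finite_measure set T1 -> \bar R}).
Variables (m2 : {sigma_finite_measure set T2 -> \bar R}).

(** The product measure is defined by sections over the first factor; Tonelli for an indicator
    exchanges the roles of the factors. *)
Lemma product_measure_ysection (A : set (T1 * T2)) : measurable A ->
  ((m1 \x m2) A = \int[m2]_y m1 (ysection A y))%E.
Proof.
move=> mA; rewrite /product_measure1.
have := indic_fubini_tonelli m1 m2 mA.
by rewrite indic_fubini_tonelli_FE // indic_fubini_tonelli_GE.
Qed.

(** Such a map acts within the fibres over the first factor, so it preserves the measure of every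
    section. *)
Lemma measure_preserving_snd (h : T1 * T2 -> T1 * T2) : measurable_fun setT h ->
  (forall p, (h p).1 = p.1) -> (forall x, measure_preserving m2 (fun y => (h (x, y)).2)) ->
  measure_preserving (m1 \x m2)%E h.
Proof.
move=> mh h1 h2; split => // A mA; rewrite /product_measure1.
apply: eq_integral => x _ /=; rewrite -[RHS](h2 x).2; last exact: measurable_xsection.
congr (m2 _); apply/seteqP; split => y; rewrite /xsection /= !inE /=.
  by rewrite {1}(surjective_pairing (h (x, y))) h1.
by rewrite {2}(surjective_pairing (h (x, y))) h1.
Qed.

Lemma measure_preserving_fst (h : T1 * T2 -> T1 * T2) : measurable_fun setT h ->
  (forall p, (h p).2 = p.2) -> (forall y, measure_preserving m1 (fun x => (h (x, y)).1)) ->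
  measure_preserving (m1 \x m2)%E h.
Proof.
move=> mh h1 h2; split => // A mA; rewrite !product_measure_ysection //; last first.
  by rewrite -[X in measurable X]setTI; exact: mh.
apply: eq_integral => y _ /=; rewrite -[RHS](h2 y).2; last exact: measurable_ysection.
congr (m1 _); apply/seteqP; split => x; rewrite /ysection /= !inE /=.
  by rewrite {1}(surjective_pairing (h (x, y))) h1.
by rewrite {2}(surjective_pairing (h (x, y))) h1.
Qed.

End MeasurePreserving.

(** * Translations and permutations preserve Lebesgue measure *)

Section LebesgueInvariance.
Context {R : realType}.
Local Notation T3 := ((R * R) * R)%type.
Local Notation lam := (@lebesgue_measure R).

(** By uniqueness of Lebesgue measure it suffices to compare the pushforward with it on half-open
    intervals. *)
Lemma measure_preserving_lebesgue (f : R -> R) : measurable_fun [set: R] f ->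
  (forall a b : R, lam (f @^-1` `]a, b]) = lam `]a, b]%classic) -> measure_preserving lam f.
Proof.
move=> mf hf; split => // A mA; apply/esym.
have mf' : @measurable_fun _ _ (measurableTypeR R) (measurableTypeR R) setT f := mf.
pose phi : {mfun measurableTypeR R >-> measurableTypeR R} :=
  HB.pack f (isMeasurableFun.Build _ _ _ _ _ mf').
have := @lebesgue_measure_unique R (pushforward lam phi); apply => // _ [[a b] _ <-].
exact/esym/hf.
Qed.

Lemma lebesgue_shift (c : R) : measure_preserving lam (fun z => z + c).
Proof.
apply: measure_preserving_lebesgue; first exact: measurable_funD.
move=> a b; rewrite (_ : _ @^-1` _ = `]a - c, b - c]%classic); last first.
  by apply/seteqP; split => x /=; rewrite !in_itv /=; lra.
rewrite !lebesgue_measure_itv /= !lte_fin ltrD2r.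
by case: ifP => // _; rewrite -!EFinB; congr _%:E; lra.
Qed.

Lemma lebesgue_reflect (c : R) : measure_preserving lam (fun z => c - z).
Proof.
apply: measure_preserving_lebesgue; first exact: measurable_funB.
move=> a b; rewrite (_ : _ @^-1` _ = `[c - b, c - a[%classic); last first.
  by apply/seteqP; split => x /=; rewrite !in_itv /=; lra.
rewrite !lebesgue_measure_itv /= !lte_fin.
rewrite (_ : (c - b < c - a) = (a < b)); last by apply/idP/idP; lra.
by case: ifP => // _; rewrite -!EFinB; congr _%:E; lra.
Qed.

(* A product of sigma-finite measures has no canonical sigma-finite structure
   in the library; the name [leb2] provides one, as needed for Fubini. *)
Definition leb2 : set (measurableTypeR R * measurableTypeR R) -> \bar R :=
  (lam \x lam)%E.
HB.instance Definition _ := Measure.on leb2.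

Lemma leb2_sigma_finite : sigma_finite setT leb2.
Proof.
have /sigma_finiteP[F [TF ndF Foo]] := sigma_finiteT lam.
exists (fun n => F n `*` F n).
  apply/seteqP; split => // -[x y] _.
  have : setT x by []. have : setT y by []. rewrite TF => -[m _ Fm] [k _ Fk].
  exists (maxn m k) => //; split => /=.
    by move: x Fk; exact/subsetPset/ndF/leq_maxr.
  by move: y Fm; exact/subsetPset/ndF/leq_maxl.
move=> n; have [mF Fn] := Foo n; split; first exact: measurableX.
by rewrite [X in (X < _)%E]product_measure1E // lte_mul_pinfty // ge0_fin_numE.
Qed.

HB.instance Definition _ :=
  Measure_isSigmaFinite.Build _ _ _ leb2 leb2_sigma_finite.

Local Notation lam3 := (leb2 \x lam)%E.

Lemma leb3E : @leb3 R = lam3.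
Proof. by []. Qed.

(** The translation is a composite of three, each of which moves a single coordinate and is handled
    fibrewise. *)
Lemma leb3_shift (v : T3) : measure_preserving (@leb3 R) (fun p => p + v).
Proof.
rewrite leb3E.
have m1 (c : R) : measure_preserving leb2 (fun q => (q.1 + c, q.2)).
  apply: measure_preserving_fst => [|//|y]; last exact: lebesgue_shift.
  apply: measurable_fun_pair; last exact: measurable_snd.
  by apply: measurable_funD; [exact: measurable_fst|exact: measurable_cst].
have m2 (c : R) : measure_preserving leb2 (fun q => (q.1, q.2 + c)).
  apply: measure_preserving_snd => [|//|y]; last exact: lebesgue_shift.
  apply: measurable_fun_pair; first exact: measurable_fst.
  by apply: measurable_funD; [exact: measurable_snd|exact: measurable_cst].
have m3 (c : R) : measure_preserving lam3 (fun q => (q.1, q.2 + c)).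
  apply: measure_preserving_snd => [|//|y]; last exact: lebesgue_shift.
  apply: measurable_fun_pair; first exact: measurable_fst.
  by apply: measurable_funD; [exact: measurable_snd|exact: measurable_cst].
have m12 h : measure_preserving leb2 h -> measure_preserving lam3 (fun q => (h q.1, q.2)).
  move=> hh; apply: measure_preserving_fst => [|//|y]; last exact: hh.
  apply: measurable_fun_pair; last exact: measurable_snd.
  exact: (measurableT_comp hh.1 measurable_fst).
rewrite (_ : (fun p => _) = (fun q => (q.1, q.2 + v.2)) \o
    ((fun q => ((q.1.1, q.1.2 + v.1.2), q.2)) \o
    (fun q => ((q.1.1 + v.1.1, q.1.2), q.2)))).
  by apply: measure_preserving_comp (m3 _) (measure_preserving_comp (m12 _ (m2 _)) (m12 _ (m1 _))).
by apply/funext => -[[x y] z]; case: v => -[].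
Qed.

(* Exchanging t4 with t_i amounts to t_i |-> c - t_i, where c is determined by
   the two other free coordinates. *)
Lemma leb3_tperm i : measure_preserving (@leb3 R) (actS (tperm i o4)).
Proof.
rewrite leb3E.
have mA k : measurable_fun setT (@actS R (tperm k o4)) := measurable_actS _.
have mfst k z : measurable_fun setT (fun q : R * R => (@actS R (tperm k o4) (q, z)).1).
  exact: (measurableT_comp measurable_fst (measurableT_comp (mA k) (measurable_pair2 z))).
move: i; apply: ord4P.
- apply: measure_preserving_fst; first exact: mA.
    by move=> p; rewrite /actS /projH /permpt /= tpermD.
  move=> z; apply: measure_preserving_fst; first exact: mfst.
    by move=> p; rewrite /actS /projH /permpt /= tpermD.
  move=> y; rewrite (_ : (fun x => _) = fun x => - (y + z) - x).
    exact: lebesgue_reflect.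
  by apply/funext => x; rewrite /actS /projH /permpt /= tpermL /embH /=; ring.
- apply: measure_preserving_fst; first exact: mA.
    by move=> p; rewrite /actS /projH /permpt /= tpermD.
  move=> z; apply: measure_preserving_snd; first exact: mfst.
    by move=> p; rewrite /actS /projH /permpt /= tpermD.
  move=> x; rewrite (_ : (fun y => _) = fun y => - (x + z) - y).
    exact: lebesgue_reflect.
  by apply/funext => y; rewrite /actS /projH /permpt /= tpermL /embH /=; ring.
- apply: measure_preserving_snd; first exact: mA.
    by move=> [[x y] z]; rewrite /actS /projH /permpt /= !tpermD.
  move=> [x y]; rewrite (_ : (fun z => _) = fun z => - (x + y) - z).
    exact: lebesgue_reflect.
  by apply/funext => z; rewrite /actS /projH /permpt /= tpermL /embH /=; ring.
- rewrite tperm1 (_ : actS 1 = id); first by split => //; exact: measurable_id.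
  apply/funext => p; rewrite /actS -[RHS]projHK; congr projH.
  by apply/funext => j; rewrite /permpt perm1.
Qed.

(** The transpositions (i 4) generate the group: (i j) is the conjugate of (j 4) by (i 4), and every
    permutation is a product of transpositions. *)
Lemma leb3_act s : measure_preserving (@leb3 R) (actS s).
Proof.
have hM u v : measure_preserving (@leb3 R) (actS u) -> measure_preserving (@leb3 R) (actS v) ->
    measure_preserving (@leb3 R) (actS (u * v)).
  move=> hu hv; rewrite (_ : actS (u * v) = actS u \o actS v); first exact: measure_preserving_comp.
  by apply/funext => p; rewrite /= actSM.
have hT i j : measure_preserving (@leb3 R) (actS (tperm i j)).
  have [->|i4] := eqVneq i o4; first by rewrite tpermC; exact: leb3_tperm.
  have [->|j4] := eqVneq j o4; first exact: leb3_tperm.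
  have [->|ij] := eqVneq i j; first by rewrite tperm1 -(tperm1 o4); exact: leb3_tperm.
  have -> : tperm i j = (tperm i o4 * (tperm j o4 * tperm i o4))%g.
    by rewrite -{1}(tpermV i o4) -conjgE tpermJ tpermR tpermD ?(eq_sym o4) // tpermC.
  exact: (hM _ _ (leb3_tperm _) (hM _ _ (leb3_tperm _) (leb3_tperm _))).
have [ts -> _] := prod_tpermP s.
elim: ts => [|t ts IH]; rewrite ?big_nil ?big_cons; last exact: (hM _ _ (hT _ _) IH).
by rewrite -(tperm1 o4); exact: leb3_tperm.
Qed.

End LebesgueInvariance.

(** * Integrals over the triangle *)

Section TriangleIntegral.
Context {R : realType}.
Local Notation T3 := ((R * R) * R)%type.
Local Notation lam := (@lebesgue_measure R).

(** * The walls are null sets *)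

Lemma measurable_wall i j (z : int) :
  measurable [set p : T3 | embH p i - embH p j = z%:~R].
Proof.
rewrite (_ : [set p | _] = [set p : T3 | embH p i - embH p j <= z%:~R] `&`
   [set p : T3 | z%:~R <= embH p i - embH p j]).
  apply: measurableI; apply: measurable_ler => //; apply: measurable_funB;
    exact: measurable_coord.
apply/seteqP; split => p /=; first by move=> ->.
by move=> [h1 h2]; apply/eqP; rewrite eq_le h1.
Qed.

(** Where t_i - t_j is injective in the third parameter, the wall meets each fibre in at most one
    point. The only pair without this property is {1, 2}; exchanging coordinates 2 and 3 reduces it
    to {1, 3}. *)
Lemma leb3_wall i j (z : int) : i != j ->
  leb3 [set p : T3 | embH p i - embH p j = z%:~R] = 0%E.
Proof.
pose W i j := [set p : T3 | embH p i - embH p j = z%:~R].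
have fib a b : (forall x y t t' : R, embH (x, y, t) a - embH (x, y, t) b =
    embH (x, y, t') a - embH (x, y, t') b -> t = t') -> leb3 (W a b) = 0%E.
  move=> h; rewrite leb3E /product_measure1 integral0_eq // => -[x y] _ /=.
  have sub t : xsection (W a b) (x, y) t -> xsection (W a b) (x, y) `<=` [set t].
    rewrite /xsection /= inE => e t'; rewrite /= inE => e'.
    by apply: (h x y); rewrite e e'.
  have [->|/set0P[t ht]] := eqVneq (xsection (W a b) (x, y)) set0; first exact: measure0.
  apply/eqP; rewrite eq_le measure_ge0 andbT -(lebesgue_measure_set1 t).
  apply: le_measure; rewrite ?inE; [|exact: measurable_set1|exact: sub].
  apply: measurable_xsection; exact: measurable_wall.
have act (s : 'S_4) a b : leb3 (W (s a) (s b)) = leb3 (W a b).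
  rewrite -[RHS](leb3_act s).2; last exact: measurable_wall.
  by congr leb3; apply/seteqP; split => p; rewrite /W /= embH_act.
have h12 a b : (a = o1 /\ b = o2) \/ (a = o2 /\ b = o1) -> leb3 (W a b) = 0%E.
  move=> ab; rewrite -(act (tperm o2 o3)); apply: fib.
  by case: ab => -[-> ->]; rewrite tpermL tpermD // /embH /= => x y t t'; lra.
move: i j; apply: ord4P; apply: ord4P => // _;
  (by apply: h12; (by left) || (by right)) || (by apply: fib => x y t t'; rewrite /embH /=; lra).
Qed.

Lemma leb3_walls (A : set T3) : measurable A -> A `<=` @walls R -> leb3 A = 0%E.
Proof.
move=> mA Aw.
(* There are countably many walls; [unpickle] enumerates them, with the empty set for codes of no
   triple and for i = j. *)
pose F n : set T3 := if @unpickle ('I_4 * 'I_4 * int)%type n is Some (i, j, z) then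
  (if i != j then [set p : T3 | embH p i - embH p j = z%:~R] else set0) else set0.
have mF n : measurable (F n).
  rewrite /F; case: unpickle => [[[i j] z]|//]; case: ifP => // _; exact: measurable_wall.
have nF n : (leb2 \x lam)%E.-negligible (F n).
  apply/negligibleP; first exact: mF.
  rewrite /F; case: unpickle => [[[i j] z]|]; last exact: measure0.
  by case: ifP => [ij|_]; [exact: leb3_wall|exact: measure0].
apply/(@negligibleP _ _ _ (leb2 \x lam)%E _ mA).
apply: negligibleS (negligible_bigcup nF).
move=> p /Aw[i [j [ij [z pz]]]]; exists (pickle (i, j, z)) => //.
by rewrite /F pickleK ij.
Qed.

Lemma measurable_box : measurable (@box R).
Proof.
rewrite (_ : @box R = (`[-1, 1] `*` `[-1, 1]) `*` `[-1, 1]).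
  by apply: measurableX => //; apply: measurableX.
apply/seteqP; split => -[[x y] z] /=; rewrite /box /= !in_itv /=.
  by move=> [].
by move=> [[]].
Qed.

Lemma leb3_box : (leb3 (@box R) < +oo)%E.
Proof.
rewrite (_ : @box R = (`[-1, 1] `*` `[-1, 1]) `*` `[-1, 1]).
  rewrite leb3E product_measure1E //; last exact: measurableX.
  have l : lam `[-1, 1]%classic = 2%:E.
    rewrite lebesgue_measure_itv /= lte_fin ifT -?EFinB; last by lra.
    by congr _%:E; lra.
  rewrite [X in (X * _)%E]product_measure1E //= l.
  by rewrite -!EFinM ltry.
apply/seteqP; split => -[[x y] z] /=; rewrite /box /= !in_itv /=.
  by move=> [].
by move=> [[]].
Qed.

(** * Cosine integrals on the unit interval and iterated integration *)

Lemma periodicz (f : R -> R) T : periodic f T -> forall (z : int) x, f (x + T *~ z) = f x.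
Proof.
move=> fT [n|n] x; first exact: periodicn.
by rewrite NegzE -[in RHS](subrK (T *+ n.+1) x) periodicn // mulrNz.
Qed.

Lemma cosDz (x : R) (z : int) : cos (x + 2 * pi * z%:~R) = cos x.
Proof.
rewrite -[RHS](periodicz (@cosD2pi R) z); congr (cos (_ + _)).
by rewrite mulrzr mulr_natl.
Qed.

Lemma sinDz (x : R) (z : int) : sin (x + 2 * pi * z%:~R) = sin x.
Proof.
rewrite -[RHS](periodicz (@sinD2pi R) z); congr (sin (_ + _)).
by rewrite mulrzr mulr_natl.
Qed.

(** For nonzero [c] a primitive takes the same value at 0 and 1. The phase [th] carries the other
    variables during iterated integration, and turns cosines into sines. *)
Lemma integral_cos (c : int) (th : R) :
  (\int[lam]_(x in `[0%R, 1%R[) (cos (2 * pi * c%:~R * x + th))%:E =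
  ((c == 0)%:R * cos th)%:E)%E.
Proof.
have [->|c0] := eqVneq c 0.
  under eq_integral do rewrite mulr0 mul0r add0r.
  have l : lam `[0, 1[%classic = 1%E.
    by rewrite lebesgue_measure_itv /= lte_fin ltr01 -EFinB subr0.
  by rewrite integral_cst //= l mule1 mul1r.
pose k := 2 * pi * c%:~R : R.
have k0 : k != 0 by rewrite /k !mulf_neq0 ?intr_eq0 // gt_eqF // pi_gt0.
pose F (x : R) := k^-1 * sin (k * x + th).
have dF (x : R) : is_derive x 1 F (cos (k * x + th)).
  have d1 : is_derive x 1 (fun x : R => k * x + th) k.
    apply: is_derive_eq; by rewrite /GRing.scale /= ?mulr1 ?addr0 ?mulr0.
  have d2 := @is_derive1_comp _ sin (fun x : R => k * x + th) x _ _ (is_derive_sin _) d1.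
  apply: (@is_derive_eq _ _ _ _ _ _ _ _ (is_deriveZ k^-1 d2)).
  by rewrite /GRing.scale /= mulrCA mulVf // mulr1.
have cf : continuous (fun x : R => cos (k * x + th)).
  move=> x; apply: (@continuous_comp _ _ _ (fun x : R => k * x + th) cos).
    by apply: cvgD; [apply: cvgM; [exact: cvg_cst|exact: cvg_id]|exact: cvg_cst].
  exact: continuous_cos.
have cF : continuous F.
  move=> x; have [dx _] := dF x; exact/differentiable_continuous/derivable1_diffP.
rewrite integral_itv_bndo_bndc; last first.
  by apply: measurable_funTS; apply/measurable_EFinP; exact: continuous_measurable_fun.
rewrite (@continuous_FTC2 R _ F) //; first last.
- by move=> x _; rewrite derive1E; have [_ ->] := dF x.
- split; first by move=> x _; have [] := dF x.
    by apply: cvg_at_right_filter; exact: cF.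
  by apply: cvg_at_left_filter; exact: cF.
- exact: continuous_subspaceT.
rewrite -EFinB /F mulr1 mulr0 add0r mul0r; congr _%:E.
by rewrite /k (addrC _ th) sinDz subrr ?mul0r.
Qed.

Lemma integral_prod d1 d2 (T1 : measurableType d1) (T2 : measurableType d2)
    (m1 : {sigma_finite_measure set T1 -> \bar R})
    (m2 : {sigma_finite_measure set T2 -> \bar R}) (A : set T1) (B : set T2)
    (f : T1 * T2 -> R) : measurable A -> measurable B ->
  (m1 \x m2)%E.-integrable (A `*` B) (EFin \o f) ->
  (\int[m1 \x m2]_(z in A `*` B) (f z)%:E =
   \int[m1]_(x in A) \int[m2]_(y in B) (f (x, y))%:E)%E.
Proof.
move=> mA mB intf; rewrite integral_mkcond -integral12_prod_meas1; last first.
  by rewrite -(integrable_mkcond _ (measurableX mA mB)).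
rewrite [RHS]integral_mkcond; apply: eq_integral => x _.
rewrite /fubini_F patchE; case: ifPn => xA.
  rewrite [RHS]integral_mkcond; apply: eq_integral => y _.
  by rewrite !patchE in_setX xA.
by apply: integral0_eq => y _; rewrite patchE in_setX (negbTE xA).
Qed.

(** * Complex integrals of bounded measurable functions *)

Definition bmeas (f : T3 -> R) :=
  measurable_fun setT f /\ exists M, forall p, `|f p| <= M.

Lemma bmeas_integrable f A : bmeas f -> boxm A -> (@leb3 R).-integrable A (EFin \o f).
Proof.
move=> [mf [M fM]] [mA bA].
apply: (@measurable_bounded_integrable _ _ _ (leb2 \x lam)%E) => //.
- apply: le_lt_trans leb3_box; apply: (@le_measure _ _ _ (leb2 \x lam)%E); rewrite ?inE //.
  exact: measurable_box.
- exact: measurable_funTS.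
- exists M; split; first exact: num_real.
  by move=> y My p _; exact: le_trans (fM p) (ltW My).
Qed.

Lemma bmeasD f g : bmeas f -> bmeas g -> bmeas (fun p => f p + g p).
Proof.
move=> [mf [M fM]] [mg [N gN]]; split; first exact: measurable_funD.
by exists (M + N) => p; exact: le_trans (ler_normD _ _) (lerD (fM p) (gN p)).
Qed.

Lemma bmeasZ c f : bmeas f -> bmeas (fun p => c * f p).
Proof.
move=> [mf [M fM]]; split; first exact: measurable_funM.
by exists (`|c| * M) => p; rewrite normrM ler_wpM2l.
Qed.

Definition cbmeas (F : T3 -> R[i]) :=
  bmeas (fun p => complex.Re (F p)) /\ bmeas (fun p => complex.Im (F p)).

(** Real and imaginary parts are integrated separately, as in the numerator of [cont_ip]. *)
Definition cint (A : set T3) (F : T3 -> R[i]) : R[i] :=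
  Complex (Rintegral (@leb3 R) A (fun p => complex.Re (F p)))
          (Rintegral (@leb3 R) A (fun p => complex.Im (F p))).

Lemma cbmeasD F G : cbmeas F -> cbmeas G -> cbmeas (fun p => F p + G p).
Proof.
move=> [F1 F2] [G1 G2]; split.
  rewrite (_ : (fun p => _) = fun p => complex.Re (F p) + complex.Re (G p)); first exact: bmeasD.
  by apply/funext => p; case: (F p); case: (G p).
rewrite (_ : (fun p => _) = fun p => complex.Im (F p) + complex.Im (G p)); first exact: bmeasD.
by apply/funext => p; case: (F p); case: (G p).
Qed.

Lemma ReZ (c x : R[i]) : complex.Re (c * x) =
  complex.Re c * complex.Re x + (- complex.Im c) * complex.Im x.
Proof. by case: c => a b; case: x => x y /=; rewrite mulNr. Qed.

Lemma ImZ (c x : R[i]) : complex.Im (c * x) =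
  complex.Re c * complex.Im x + complex.Im c * complex.Re x.
Proof. by case: c => a b; case: x => x y. Qed.

Lemma cbmeasZ c F : cbmeas F -> cbmeas (fun p => c * F p).
Proof.
move=> [F1 F2]; split; [under eq_fun do rewrite ReZ|under eq_fun do rewrite ImZ];
  by apply: bmeasD; apply: bmeasZ.
Qed.

Lemma cintD A F G : boxm A -> cbmeas F -> cbmeas G ->
  cint A (fun p => F p + G p) = cint A F + cint A G.
Proof.
move=> hA [F1 F2] [G1 G2]; have mA := hA.1.
rewrite /cint /=; congr Complex.
  rewrite -(@RintegralD _ _ _ (leb2 \x lam)%E) //; try exact: bmeas_integrable.
  by apply: eq_Rintegral => p _; case: (F p); case: (G p).
rewrite -(@RintegralD _ _ _ (leb2 \x lam)%E) //; try exact: bmeas_integrable.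
by apply: eq_Rintegral => p _; case: (F p); case: (G p).
Qed.

Lemma cintZ A c F : boxm A -> cbmeas F -> cint A (fun p => c * F p) = c * cint A F.
Proof.
move=> hA [F1 F2]; have mA := hA.1.
have int f k : bmeas f -> Rintegral (leb2 \x lam)%E A (fun p => k * f p) =
    k * Rintegral (leb2 \x lam)%E A f.
  by move=> hf; rewrite (@RintegralZl _ _ _ (leb2 \x lam)%E) //; exact: bmeas_integrable.
apply/eqP; rewrite eq_complex ReZ ImZ /=; apply/andP; split; apply/eqP.
  under eq_Rintegral do rewrite ReZ.
  rewrite (@RintegralD _ _ _ (leb2 \x lam)%E) ?int //;
    by apply: bmeas_integrable => //; exact: bmeasZ.
under eq_Rintegral do rewrite ImZ.
rewrite (@RintegralD _ _ _ (leb2 \x lam)%E) ?int //;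
  by apply: bmeas_integrable => //; exact: bmeasZ.
Qed.

Lemma cintU F A B : cbmeas F -> boxm A -> boxm B -> A `&` B = set0 ->
  cint (A `|` B) F = cint A F + cint B F.
Proof.
move=> [F1 F2] [mA bA] [mB bB] AB.
have hAB : boxm (A `|` B).
  by split; [exact: measurableU|move=> p [/bA|/bB]].
rewrite /cint /=; congr Complex; apply: (@Rintegral_setU _ _ _ (leb2 \x lam)%E) => //;
  (by apply/disj_set2P) || exact: bmeas_integrable.
Qed.

Lemma cint_walls F A : cbmeas F -> boxm A -> A `<=` @walls R -> cint A F = 0.
Proof.
move=> [[F1 _] [F2 _]] [mA _] Aw.
rewrite /cint /Rintegral !(@null_set_integral _ _ _ (leb2 \x lam)%E) //;
  try (apply: measurable_funTS; exact/measurable_EFinP); exact: leb3_walls.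
Qed.

Lemma cint_measure_preserving F h A : cbmeas F -> measure_preserving (@leb3 R) h -> F \o h = F ->
  boxm A -> boxm (h @^-1` A) -> cint (h @^-1` A) F = cint A F.
Proof.
move=> [F1 F2] hh Fh hA hhA; have mA := hA.1.
have Fp p : F (h p) = F p by rewrite -[in RHS]Fh.
rewrite /cint /Rintegral; congr (Complex (fine _) (fine _));
  apply: (@measure_preserving_integral _ _ _ (leb2 \x lam)%E) => //;
  try exact: bmeas_integrable; try (by apply/funext => p /=; rewrite Fp);
  apply/measurable_EFinP; [exact: F1.1|exact: F2.1].
Qed.

(** Instance of [folding]: walls are null, and translations and permutations preserve the measure
    and the integrand. *)
Lemma cint_folding F : cbmeas F ->
  (forall b p, F (p + natvec R b) = F p) -> (forall s p, F (actS s p) = F p) ->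
  cint (@cubeQ R) F = cint (@simplex0 R) F *+ 24.
Proof.
move=> hF Fs Fa; apply: (@folding R _ (fun A => cint A F)).
- by move=> A B; exact: cintU.
- by move=> A; exact: cint_walls.
- move=> b A hA hbA; apply: cint_measure_preserving => //; first exact: leb3_shift.
  by apply/funext => p /=.
- move=> s A hA hsA; apply: cint_measure_preserving => //; first exact: leb3_act.
  by apply/funext => p /=.
Qed.

(** * Exponentials integrated over the unit cube *)

Definition lin3 (a b c : int) (p : T3) : R :=
  2 * pi * a%:~R * p.1.1 + 2 * pi * b%:~R * p.1.2 + 2 * pi * c%:~R * p.2.

Lemma measurable_lin3 a b c th : measurable_fun setT (fun p : T3 => lin3 a b c p + th).
Proof.
apply: measurable_funD => //; apply: measurable_funD; first apply: measurable_funD.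
- by apply: measurable_funM => //; exact: (measurable_coord o1).
- by apply: measurable_funM => //; exact: (measurable_coord o2).
- by apply: measurable_funM => //; exact: (measurable_coord o3).
Qed.

Lemma bmeas_cos a b c th : bmeas (fun p => cos (lin3 a b c p + th)).
Proof.
split; last by exists 1 => p; exact: cos_max.
apply: (measurableT_comp _ (measurable_lin3 a b c th)).
exact: (continuous_measurable_fun (@continuous_cos R)).
Qed.

Lemma cos_integrable d (T : measurableType d) (m : {measure set T -> \bar R})
    (A : set T) (g : T -> R) (k : R) :
  measurable A -> (m A < +oo)%E -> measurable_fun setT g ->
  m.-integrable A (EFin \o (fun x => k * cos (g x))).
Proof.
move=> mA Aoo mg; apply: measurable_bounded_integrable => //.
  apply: measurable_funTS; apply: measurable_funM => //.
  by apply: (measurableT_comp _ mg); exact: (continuous_measurable_fun (@continuous_cos R)).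
exists `|k|; split; first exact: num_real.
move=> y ky x _ /=; rewrite normrM; apply: le_trans (ltW ky).
by rewrite ler_piMr // cos_max.
Qed.

Lemma cos_integrable1 d (T : measurableType d) (m : {measure set T -> \bar R})
    (A : set T) (g : T -> R) :
  measurable A -> (m A < +oo)%E -> measurable_fun setT g ->
  m.-integrable A (EFin \o (fun x => cos (g x))).
Proof.
move=> mA Aoo mg; have := cos_integrable 1 mA Aoo mg.
by rewrite (_ : (fun x => 1 * _) = fun x => cos (g x)) //; apply/funext => x; rewrite mul1r.
Qed.

(** Fubini: the variables t3, t2, t1 are integrated in this order, and each one contributes the
    factor 1 or 0 according to whether its frequency vanishes. *)
Lemma Rintegral_cos a b c th :
  Rintegral (@leb3 R) (@cubeQ R) (fun p => cos (lin3 a b c p + th)) =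
  [&& a == 0, b == 0 & c == 0]%:R * cos th.
Proof.
have cubeE : @cubeQ R = (`[0, 1[ `*` `[0, 1[) `*` `[0, 1[.
  apply/seteqP; split => -[[x y] z] /=; rewrite /cubeQ /= !in_itv /=; first by move=> [].
  by move=> [[]].
have hint d e f t := bmeas_integrable (bmeas_cos d e f t) boxm_cubeQ.
rewrite /Rintegral cubeE (@integral_prod _ _ _ _ leb2 lam) //; first last.
- by rewrite -cubeE.
- exact: measurableX.
have l01 : lam `[0, 1[%classic = 1%E.
  by rewrite lebesgue_measure_itv /= lte_fin ltr01 -EFinB subr0.
have f01 : (lam `[0%R, 1%R[%classic < +oo)%E by rewrite l01 ltry.
pose g2 (x : R * R) := 2 * pi * a%:~R * x.1 + 2 * pi * b%:~R * x.2 + th.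
pose g1 (x : R) := 2 * pi * a%:~R * x + th.
have mg2 : measurable_fun setT g2.
  by apply: measurable_funD => //; apply: measurable_funD; apply: measurable_funM.
have mg2x x : measurable_fun setT (fun y => g2 (x, y)).
  exact: (measurableT_comp mg2 (measurable_pair1 x)).
have mg1 : measurable_fun setT g1.
  by apply: measurable_funD => //; apply: measurable_funM.
transitivity (fine (\int[leb2]_(x in `[0%R, 1%R[ `*` `[0%R, 1%R[)
    ((c == 0)%:R * cos (g2 x))%:E)%E).
  congr fine; apply: eq_integral => x _; rewrite -integral_cos.
  by apply: eq_integral => y _; congr (cos _)%:E; rewrite /lin3 /g2 /=; ring.
rewrite (@integral_prod _ _ _ _ lam lam (`[0%R, 1%R[) (`[0%R, 1%R[)
  (fun x => (c == 0)%:R * cos (g2 x))) //; last first.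
  apply: (@cos_integrable _ _ (lam \x lam)%E) => //; first exact: measurableX.
  by rewrite [X in (X < _)%E]product_measure1E //= l01 mule1 ltry.
transitivity (fine (\int[lam]_(x in `[0%R, 1%R[)
    (((c == 0)%:R * (b == 0)%:R) * cos (g1 x))%:E)%E).
  congr fine; apply: eq_integral => x _; rewrite -mulrA EFinM -integral_cos.
  rewrite -integralZl //.
    by apply: eq_integral => y _; rewrite -EFinM; congr (_ * cos _)%:E; rewrite /g2 /g1 /=; ring.
  apply: (@cos_integrable1 _ _ lam _ (fun y => 2 * pi * b%:~R * y + g1 x)) => //.
  by apply: measurable_funD => //; apply: measurable_funM.
under eq_integral do rewrite EFinM.
rewrite integralZl //; last exact: (@cos_integrable1 _ _ lam _ g1).
rewrite integral_cos -EFinM /=.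
by case: eqP; case: eqP; case: eqP; rewrite /= ?mul1r ?mul0r ?mulr0.
Qed.

Lemma cbmeas_expi a b c : cbmeas (fun p => expi (lin3 a b c p)).
Proof.
split => /=.
  rewrite (_ : (fun p => _) = fun p => cos (lin3 a b c p + 0)); first exact: bmeas_cos.
  by apply/funext => p; rewrite addr0.
(* A sine is a cosine with phase -pi/2. *)
rewrite (_ : (fun p => _) = fun p => cos (lin3 a b c p + (- (pi / 2)))); first exact: bmeas_cos.
by apply/funext => p; rewrite -sinDpihalf subrK.
Qed.

Lemma cint_expi a b c :
  cint (@cubeQ R) (fun p => expi (lin3 a b c p)) = [&& a == 0, b == 0 & c == 0]%:R.
Proof.
rewrite /cint /=.
have := Rintegral_cos a b c 0; under eq_Rintegral do rewrite addr0.
move=> ->; rewrite cos0 mulr1.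
have := Rintegral_cos a b c (- (pi / 2)).
under eq_Rintegral do rewrite -sinDpihalf -addrA addNr addr0.
move=> ->; rewrite -sinDpihalf addNr sin0 mulr0.
by case: [&& _, _ & _].
Qed.

End TriangleIntegral.

(** * Sums over the lattice *)

Section LatticeSum.
Context {R : realType}.
Local Notation T3 := ((R * R) * R)%type.

Lemma fsbig_pred (V : nmodType) (T : finType) (P : pred T) (f : T -> V) :
  \sum_(i \in [set` P]) f i = \sum_(i | P i) f i.
Proof.
by apply/esym/bigfs => [|i _]; [exact: index_enum_uniq|rewrite mem_index_enum].
Qed.

Lemma fsbig_setT (V : nmodType) (T : finType) (f : T -> V) :
  \sum_(i \in [set: T]) f i = \sum_i f i.
Proof.
by rewrite -[RHS]fsbig_pred; congr (\big[_/_]_(i \in _) _); apply/seteqP; split.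
Qed.

(** * Exponentials and sums of roots of unity *)

Lemma expiD (x y : R) : expi (x + y) = expi x * expi y.
Proof.
by apply/eqP; rewrite eq_complex /= cosD sinD eqxx /= addrC (mulrC (sin x)) (mulrC (cos x)) eqxx.
Qed.

Lemma expi0 : expi 0 = 1 :> R[i].
Proof. by rewrite /expi cos0 sin0. Qed.

Lemma expiDz (x : R) (z : int) : expi (x + 2 * pi * z%:~R) = expi x.
Proof. by rewrite /expi cosDz sinDz. Qed.

Lemma expi_conj (x : R) : (expi x)^* = expi (- x).
Proof. by rewrite /expi cosN sinN. Qed.

Lemma expiMn (x : R) n : expi (x *+ n) = expi x ^+ n.
Proof. by elim: n => [|n IH]; rewrite ?expi0 // mulrS expiD IH exprS. Qed.

(** With [r] the residue of [q] modulo [m] and y = pi r / m in [0, pi), the real part says cos (2 y)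
    = 1, so that sin y = 0, which forces r = 0. *)
Lemma expi_eq1 (q : int) (m : nat) : (0 < m)%N ->
  expi (2 * pi * (q%:~R / m%:R) : R) = 1 -> (m%:Z %| q)%Z.
Proof.
move=> m0; have mR : (m%:R : R) != 0 by rewrite pnatr_eq0 -lt0n.
set r := (q %% m)%Z; have qE := divz_eq q m; rewrite -/r in qE.
have hr0 : 0 <= r by apply: modz_ge0; rewrite -lt0n.
have hrm : r < m by apply: ltz_pmod.
have -> : 2 * pi * (q%:~R / m%:R) = 2 * (pi * (r%:~R / m%:R)) + 2 * pi * (q %/ m)%Z%:~R :> R.
  by rewrite {1}qE rmorphD rmorphM /=; field.
rewrite expiDz => /eqP; rewrite eq_complex /= => /andP[/eqP + _].
set y := pi * (r%:~R / m%:R) => cos1.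
have : sin y = 0.
  apply/eqP; rewrite -sqrf_eq0; apply/eqP.
  have := cos2Dsin2 y; move: cos1; rewrite mulr_natl mulr2n cosD -!expr2; lra.
have mpos : 0 < m%:R :> R by rewrite ltr0n.
have [r0 _|r0] := eqVneq r 0; first by apply/dvdzP; exists (q %/ m)%Z; rewrite {1}qE r0 addr0.
have rpos : 0 < r by rewrite lt_neqAle eq_sym r0.
have ym : y < pi.
  rewrite /y gtr_pMr ?pi_gt0 // ltr_pdivrMr // mul1r.
  by rewrite (_ : m%:R = m%:Z%:~R :> R) // ltr_int.
move=> siny; suff : 0 < sin y by rewrite siny ltxx.
apply: sin_gt0_pi; rewrite ym andbT /y mulr_gt0 ?pi_gt0 // divr_gt0 // ltr0z.
exact: rpos.
Qed.

(** A geometric sum whose ratio [z] satisfies z^m = 1: it vanishes unless z = 1, which happens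
    exactly when [m] divides [q]. *)
Lemma geometric_expi (q : int) (m : nat) : (0 < m)%N ->
  \sum_(a < m) expi (2 * pi * (q%:~R * a%:R / m%:R) : R) = (m%:Z %| q)%Z%:R *+ m.
Proof.
move=> m0; have mR : (m%:R : R) != 0 by rewrite pnatr_eq0 -lt0n.
set z := expi (2 * pi * (q%:~R / m%:R) : R).
have zE a : expi (2 * pi * (q%:~R * a%:R / m%:R) : R) = z ^+ a.
  by rewrite -expiMn -mulr_natr; congr expi; field.
rewrite (eq_bigr (fun a : 'I_m => z ^+ a)) => [|a _]; last exact: zE.
have zm : z ^+ m = 1.
  by rewrite -zE mulfK // -[X in expi X]add0r expiDz expi0.
case: (boolP (m%:Z %| q)%Z) => [/dvdzP[d qE]|ndvd].
  have -> : z = 1.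
    rewrite /z qE rmorphM /= -pmulrn mulfK // -[X in expi X]add0r expiDz expi0 //.
  under eq_bigr do rewrite expr1n.
  by rewrite sumr_const card_ord.
rewrite mul0rn; have /eqP := subrX1 z m; rewrite zm subrr eq_sym mulf_eq0 => /orP[|/eqP //].
rewrite subr_eq0 => /eqP /(expi_eq1 m0); by rewrite (negbTE ndvd).
Qed.

(** The form of [inH] that treats all pairs of indices alike, which makes its stability under
    permutations plain. *)
Definition zero_sum_congruent (k : ivec) :=
  (\sum_(i < 4) k i = 0) /\ forall i j, (4 %| k i - k j)%Z.

Lemma inHP k : reflect (zero_sum_congruent k) (inH k).
Proof.
apply: (iffP and4P) => [[/eqP h0 h1 h2 h3]|[h0 h]]; last by split; rewrite ?h0.
split => //; have hs a b : (4 %| a - b)%Z -> (4 %| b - a)%Z by rewrite -opprB rpredN.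
have ht a b c : (4 %| a - b)%Z -> (4 %| b - c)%Z -> (4 %| a - c)%Z.
  by move=> ab bc; rewrite -(subrKA b) rpredD.
have h13 := ht _ _ _ h1 h2; have h24 := ht _ _ _ h2 h3; have h14 := ht _ _ _ h1 h24.
by apply: ord4P; apply: ord4P; rewrite ?subrr ?dvdz0 //; exact: hs.
Qed.

(** * The lattice in the chart, and its sums over bounded sets *)

Variable n : nat.
Hypothesis n_gt0 : (0 < n)%N.

Definition lattice : set T3 := [set p | exists k : ivec,
  inH k /\ forall i, embH p i = (k i)%:~R / (4 * n)%:R].

Lemma n4_neq0 : (4 * n)%:R != 0 :> R.
Proof. by rewrite pnatr_eq0 muln_eq0 -lt0n. Qed.

Lemma lattice_act s p : lattice p -> lattice (actS s p).
Proof.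
move=> [k [/inHP[h0 hk] pk]]; exists (fun i => k (s i)); split.
  apply/inHP; split => [|i j]; last exact: hk.
  by rewrite -[RHS]h0 [RHS](reindex_inj (@perm_inj _ s)).
by move=> i; rewrite embH_act /permpt pk.
Qed.

(** Entries of either sign, to cover the translations by [natvec] together with their inverses. *)
Definition intvec (m : int * int * int) : T3 := (m.1.1%:~R, m.1.2%:~R, m.2%:~R).

Lemma lattice_shift m p : lattice p -> lattice (p + intvec m).
Proof.
move=> [k [/inHP[h0 hk] pk]].
pose c : ivec := fun i => match val i with
  | 0 => m.1.1 | 1 => m.1.2 | 2 => m.2 | _ => - (m.1.1 + m.1.2 + m.2) end.
exists (fun i => k i + (4 * n)%:Z * c i); split.
  apply/inHP; split.
    by rewrite big_split /= h0 add0r -mulr_sumr sum4E /c /=; lia.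
  move=> i j; rewrite opprD addrACA -mulrBr rpredD //.
  by apply: dvdz_mulr; rewrite PoszM dvdz_mulr.
move=> i; rewrite embHD pk intrD intrM mulrDl -pmulrn mulrAC divff ?n4_neq0 // mul1r.
congr (_ + _); move: i; apply: ord4P; rewrite /c /embH /intvec //=.
by rewrite rmorphN !rmorphD.
Qed.

(** Coordinates in [-1, 1] have numerators between -4n and 4n, which leaves 8n + 1 values for
    each. *)
Lemma box_lattice_finite : finite_set (@box R `&` lattice).
Proof.
pose h (x : 'I_(8 * n + 1) * 'I_(8 * n + 1) * 'I_(8 * n + 1)) : T3 :=
  ((x.1.1%:Z - (4 * n)%:Z)%:~R / (4 * n)%:R, (x.1.2%:Z - (4 * n)%:Z)%:~R / (4 * n)%:R,
   (x.2%:Z - (4 * n)%:Z)%:~R / (4 * n)%:R).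
apply: (@sub_finite_set _ _ (h @` setT)); last exact: finite_image.
have N0 : 0 < (4 * n)%:R :> R by rewrite lt_neqAle eq_sym n4_neq0 ler0n.
have key (x : R) (k : int) : -1 <= x <= 1 -> x = k%:~R / (4 * n)%:R ->
    exists j : 'I_(8 * n + 1), x = (j%:Z - (4 * n)%:Z)%:~R / (4 * n)%:R.
  move=> hx xE; move: hx; rewrite xE ler_pdivlMr // ler_pdivrMr // mul1r.
  have -> : -1 * (4 * n)%:R = (- (4 * n)%:Z)%:~R :> R by rewrite mulN1r intrN -pmulrn.
  have -> : (4 * n)%:R = (4 * n)%:Z%:~R :> R by rewrite -pmulrn.
  rewrite !ler_int => /andP[k1 k2].
  have kj : (`|(k + (4 * n)%:Z)%R|%N < 8 * n + 1)%N by lia.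
  exists (Ordinal kj) => /=; congr (_%:~R / _); lia.
move=> [[x y] z] [[/= hx hy hz] [k [_ pk]]].
have [a aE] := key _ _ hx (pk o1); have [b bE] := key _ _ hy (pk o2).
have [c cE] := key _ _ hz (pk o3).
by exists (a, b, c) => //; rewrite /h /= -aE -bE -cE.
Qed.

Definition dsum (A : set T3) (F : T3 -> R[i]) : R[i] := \sum_(p \in A `&` lattice) F p.

Lemma boxm_lattice_finite A : boxm A -> finite_set (A `&` lattice).
Proof. by move=> [_ bA]; apply: sub_finite_set box_lattice_finite; exact: setSI. Qed.

Lemma dsumU F A B : boxm A -> boxm B -> A `&` B = set0 ->
  dsum (A `|` B) F = dsum A F + dsum B F.
Proof.
move=> hA hB AB; rewrite /dsum setIUl fsbigU //; try exact: boxm_lattice_finite.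
by move=> p [[Ap _] [Bp _]]; have : (A `&` B) p by []; rewrite AB.
Qed.

Lemma dsum_bij F (h h' : T3 -> T3) A : cancel h h' -> cancel h' h ->
  (forall p, lattice p -> lattice (h p)) -> (forall p, lattice p -> lattice (h' p)) ->
  (forall p, F (h p) = F p) -> dsum (h @^-1` A) F = dsum A F.
Proof.
move=> hK h'K hL h'L Fh; rewrite /dsum [RHS](@reindex_fsbig _ _ _ _ _ h (h @^-1` A `&` lattice)).
  by apply: eq_fsbigr => p _; rewrite Fh.
split.
- by move=> p [Ap Lp]; split => //; exact: hL.
- by apply: in2W; exact: can_inj hK.
- by move=> p [Ap Lp]; exists (h' p); rewrite ?h'K //; split; rewrite /= ?h'K //; exact: h'L.
Qed.

Lemma actSK s : cancel (@actS R s) (actS s^-1).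
Proof.
move=> p; rewrite actSM mulVg /actS -[RHS]projHK; congr projH.
by apply/funext => i; rewrite /permpt perm1.
Qed.

(** Instance of [folding] for the counting measure. Lattice points do lie on the walls, so [F] is
    required to vanish there. *)
Lemma dsum_folding F : (forall b p, F (p + natvec R b) = F p) ->
  (forall s p, F (actS s p) = F p) ->
  (forall p, @walls R p -> F p = 0) ->
  dsum (@cubeQ R) F = dsum (@simplex0 R) F *+ 24.
Proof.
move=> Fs Fa F0; apply: (@folding R _ (fun A => dsum A F)).
- by move=> A B; exact: dsumU.
- by move=> A _ Aw; rewrite /dsum fsbig1 // => p [/Aw/F0].
- move=> b A _ _; apply: (dsum_bij (h' := fun p => p - natvec R b)) => //.
  + by move=> p; rewrite addrK.
  + by move=> p; rewrite subrK.
  + move=> p /(lattice_shift (b.1.1%:Z, b.1.2%:Z, b.2%:Z)).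
    by rewrite /intvec /natvec /= -!pmulrn.
  + move=> p /(lattice_shift (- b.1.1%:Z, - b.1.2%:Z, - b.2%:Z)).
    by rewrite /intvec /natvec /= !rmorphN /= -!pmulrn.
- move=> s A _ _; apply: (dsum_bij (h' := actS s^-1)) => //.
  + exact: actSK.
  + by move=> p; rewrite -{1}(invgK s) actSK.
  + exact: lattice_act.
  + exact: lattice_act.
Qed.

(** The numerators k1, k2, k3 range over [0, 4n) with a common residue s modulo 4; then k4 = -(k1 +
    k2 + k3) is congruent to -3s, that is to s, as it must be. *)
Lemma dsum_cubeQ F : dsum (@cubeQ R) F =
  \sum_(s < 4) \sum_(a < n) \sum_(b < n) \sum_(c < n)
    F ((s + 4 * a)%:R / (4 * n)%:R, (s + 4 * b)%:R / (4 * n)%:R, (s + 4 * c)%:R / (4 * n)%:R).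
Proof.
pose h (x : 'I_4 * ('I_n * ('I_n * 'I_n))) : T3 :=
  ((x.1 + 4 * x.2.1)%:R / (4 * n)%:R, (x.1 + 4 * x.2.2.1)%:R / (4 * n)%:R,
   (x.1 + 4 * x.2.2.2)%:R / (4 * n)%:R).
have N0 : 0 < (4 * n)%:R :> R by rewrite lt_neqAle eq_sym n4_neq0 ler0n.
have hinj (x y : nat) : x%:R / (4 * n)%:R = y%:R / (4 * n)%:R :> R -> x = y.
  by move=> /(mulIf (invr_neq0 n4_neq0))/eqP; rewrite eqr_nat => /eqP.
rewrite /dsum (@reindex_fsbig _ _ _ _ _ h setT).
  rewrite fsbig_setT -(pair_bigA _ (fun s x => F (h (s, x)))) /=.
  apply: eq_bigr => s _; rewrite -(pair_bigA _ (fun a x => F (h (s, (a, x))))) /=.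
  apply: eq_bigr => a _.
  by rewrite -(pair_bigA _ (fun b c => F (h (s, (a, (b, c)))))).
split.
- move=> [s [a [b c]]] _; rewrite /h /=; split.
    have lt (x : 'I_n) : 0 <= ((s + 4 * x)%:R / (4 * n)%:R : R) < 1.
      rewrite divr_ge0 ?ler0n //= ltr_pdivrMr // mul1r ltr_nat.
      by have := ltn_ord s; have := ltn_ord x; lia.
    by split; exact: lt.
  exists (fun i => match val i with 0 => (s + 4 * a)%:Z | 1 => (s + 4 * b)%:Z
    | 2 => (s + 4 * c)%:Z | _ => - (3 * s + 4 * (a + b + c))%:Z end); split.
    apply/inHP; split; first by rewrite sum4E /=; lia.
    by apply: ord4P; apply: ord4P => /=; lia.
  apply: ord4P; rewrite /embH //=.
  have q (u : nat) : (s + 4 * u)%:R = s%:R + 4 * u%:R :> R by rewrite natrD natrM.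
  have q4 : (3 * s + 4 * (a + b + c))%:R = 3 * s%:R + 4 * (a%:R + b%:R + c%:R) :> R.
    by rewrite natrD !natrM !natrD.
  by rewrite intrN -pmulrn q4 !q -!mulrDl -mulNr; congr (_ / _); ring.
- move=> [s [a [b c]]] [s' [a' [b' c']]] _ _ [/hinj h1 /hinj h2 /hinj h3].
  have [e1 e2] : s = s' /\ a = a'.
    by split; apply: val_inj => /=; move: (ltn_ord s) (ltn_ord s') h1; lia.
  have e3 : b = b' by apply: val_inj => /=; move: h2; rewrite e1; lia.
  have e4 : c = c' by apply: val_inj => /=; move: h3; rewrite e1; lia.
  by rewrite e1 e2 e3 e4.
- move=> [[x y] z] [[/= hx hy hz] [k [/inHP[_ hk] pk]]].
  have key (t : R) (i : int) : 0 <= t < 1 -> t = i%:~R / (4 * n)%:R ->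
      exists2 m : nat, i = m%:Z & (m < 4 * n)%N.
    move=> /andP[t0 t1] tE; rewrite tE in t0 t1.
    have i0 : 0 <= i by rewrite -(ler_int R) -(@pmulr_lge0 _ (4 * n)%:R^-1) ?invr_gt0.
    have i1 : i < (4 * n)%:Z.
      by rewrite -(ltr_int R) -pmulrn; move: t1; rewrite ltr_pdivrMr // mul1r.
    by exists `|i|%N; lia.
  have [k1 e1 l1] := key _ _ hx (pk o1); have [k2 e2 l2] := key _ _ hy (pk o2).
  have [k3 e3 l3] := key _ _ hz (pk o3).
  have d12 := hk o1 o2; have d13 := hk o1 o3; rewrite e1 ?e2 ?e3 in d12 d13.
  have hs : (k1 %% 4 < 4)%N by rewrite ltn_mod.
  have q1 : (k1 %/ 4 < n)%N by lia.
  have q2 : (k2 %/ 4 < n)%N by lia.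
  have q3 : (k3 %/ 4 < n)%N by lia.
  exists (Ordinal hs, (Ordinal q1, (Ordinal q2, Ordinal q3))) => //.
  rewrite /h /=; congr (_, _, _).
  + rewrite [RHS](pk o1) e1 -pmulrn; congr (_%:R / _); lia.
  + rewrite [RHS](pk o2) e2 -pmulrn; congr (_%:R / _); lia.
  + rewrite [RHS](pk o3) e3 -pmulrn; congr (_%:R / _); lia.
Qed.

(** The exponential splits into one factor for each summation index. The three inner sums give n^3
    or 0 by divisibility of a, b, c by n; after division by n, the sum over the residue [s] gives 4
    or 0. *)
Lemma dsum_expi a b c : dsum (@cubeQ R) (fun p => expi (lin3 a b c p)) =
  [&& (n %| a)%Z, (n %| b)%Z, (n %| c)%Z & ((4 * n)%N %| a + b + c)%Z]%:R *+ (4 * n ^ 3).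
Proof.
pose w (q : int) (m x : nat) : R[i] := expi (2 * pi * (q%:~R * x%:R / m%:R)).
have nR : (n%:R : R) != 0 by rewrite pnatr_eq0 -lt0n.
have E (s : 'I_4) (x y z : 'I_n) : expi (lin3 a b c ((s + 4 * x)%:R / (4 * n)%:R,
      (s + 4 * y)%:R / (4 * n)%:R, (s + 4 * z)%:R / (4 * n)%:R)) =
    w (a + b + c) (4 * n)%N s * (w a n x * (w b n y * w c n z)).
  have q (u : nat) : (s + 4 * u)%:R / (4 * n)%:R = (s%:R + 4 * u%:R) / (4 * n%:R) :> R.
    by rewrite natrD !natrM.
  rewrite /w -!expiD !q !natrM; congr expi; rewrite /lin3 /= !intrD.
  by field; rewrite nR.
rewrite dsum_cubeQ; under eq_bigr do under eq_bigr do under eq_bigr do under eq_bigr do rewrite E.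
under eq_bigr do under eq_bigr do under eq_bigr do rewrite -!mulr_sumr (geometric_expi c n_gt0).
under eq_bigr do under eq_bigr do rewrite -!mulr_sumr -mulr_suml (geometric_expi b n_gt0).
under eq_bigr do rewrite -mulr_sumr -mulr_suml (geometric_expi a n_gt0).
rewrite -mulr_suml.
case: (boolP (n %| a)%Z) => [/dvdzP[a' ->]|_]; last by rewrite !(mul0rn, mul0r, mulr0).
case: (boolP (n %| b)%Z) => [/dvdzP[b' ->]|_]; last by rewrite !(mul0rn, mul0r, mulr0).
case: (boolP (n %| c)%Z) => [/dvdzP[c' ->]|_]; last by rewrite !(mul0rn, mul0r, mulr0).
rewrite -!mulrDl PoszM dvdz_mul2r //= -?lt0n //.
rewrite (eq_bigr (fun s : 'I_4 => expi (2 * pi * ((a' + b' + c')%:~R * s%:R / 4%:R)))).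
  rewrite geometric_expi // mulr1n -!natrM mulr_natr -mulrnA.
  by rewrite !expnS expn0 muln1.
by move=> s _; rewrite /w; congr expi; rewrite !rmorphM /= -pmulrn natrM; field; rewrite nR.
Qed.

End LatticeSum.

(** * Comparison of the two inner products *)

Section Quadrature.
Context {R : realType}.
Local Notation T3 := ((R * R) * R)%type.
Variable n : nat.
Hypothesis n_gt0 : (0 < n)%N.

(** The phase changes by pi/2 times k.m; all k_i are congruent to k_4 modulo 4 and [m] has zero sum,
    so that 4 divides k.m. *)
Lemma phi_shift (k m : ivec) (t : pt4 R) : inH k -> \sum_(i < 4) m i = 0 ->
  phi k (fun i => t i + (m i)%:~R) = phi k t.
Proof.
move=> /inHP[k0 hk] m0.
pose c i := ((k i - k o4) %/ 4)%Z.
have cE i : k i = 4 * c i + k o4 by rewrite /c mulrC divzK ?hk // subrK.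
have -> : phi k (fun i => t i + (m i)%:~R) =
    expi (pi / 2 * dotk k t + 2 * pi * (\sum_(i < 4) c i * m i)%:~R).
  rewrite /phi; congr expi.
  have -> : dotk k (fun i => t i + (m i)%:~R) = dotk k t + (\sum_(i < 4) k i * m i)%:~R.
    rewrite /dotk rmorph_sum -big_split /=; apply: eq_bigr => i _.
    by rewrite mulrDr intrM.
  have -> : \sum_(i < 4) k i * m i = 4 * \sum_(i < 4) c i * m i.
    rewrite (eq_bigr (fun i => 4 * (c i * m i) + k o4 * m i)) => [|i _].
      by rewrite big_split /= -!mulr_sumr m0 mulr0 addr0.
    by rewrite {1}cE mulrDl mulrA.
  by rewrite intrM; field.
by rewrite expiDz.
Qed.

Lemma TS_shift (k m : ivec) (t : pt4 R) : inH k -> \sum_(i < 4) m i = 0 ->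
  TS k (fun i => t i + (m i)%:~R) = TS k t.
Proof.
move=> hk m0; rewrite /TS; congr (_ * _); apply: eq_bigr => s _; congr (_ * _).
apply: (@phi_shift k (fun i => m (s i))) => //.
by rewrite -[RHS]m0 [RHS](reindex_inj (@perm_inj _ s)).
Qed.

Lemma TS_perm (k : ivec) (t : pt4 R) s : TS k (permpt t s) = (-1) ^+ odd_perm s * TS k t.
Proof.
rewrite /TS [RHS]mulrCA; congr (_ * _); rewrite mulr_sumr.
rewrite [RHS](reindex_inj (mulIg s)) /=; apply: eq_bigr => u _.
rewrite mulrA odd_permM signr_addb mulrCA -expr2 sqrr_sign mulr1.
congr (_ * phi _ _); apply/funext => i; by rewrite /permpt permM.
Qed.

(** What folding uses of an element of the span: translations act trivially and permutations by
    their sign. *)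
Definition TSn_alternating (f : pt4 R -> R[i]) :=
  (forall m t, \sum_(i < 4) m i = 0 -> f (fun i => t i + (m i)%:~R) = f t) /\
  (forall s t, f (permpt t s) = (-1) ^+ odd_perm s * f t).

Lemma inTSn_alternating f : inTSn n f -> TSn_alternating f.
Proof.
move=> [r [/allP hr ->]]; split=> [m t m0|s t].
  rewrite !big_seq; apply: eq_bigr => q /hr /and5P[hq _ _ _ _].
  by rewrite TS_shift.
by rewrite mulr_sumr; apply: eq_bigr => q _; rewrite TS_perm mulrCA.
Qed.

(** On the wall t_i - t_j = z, exchanging t_i and t_j amounts to an integer translation, by -z at i
    and z at j. Hence f = - f there. *)
Lemma alternating_walls f p : TSn_alternating f -> @walls R p -> f (embH p) = 0.
Proof.
move=> [fs fa] [i [j [ij [z pz]]]].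
pose m : ivec := fun l => if l == i then - z else if l == j then z else 0.
have m0 : \sum_(l < 4) m l = 0.
  rewrite (bigD1 i) //= (bigD1 j) 1?eq_sym //= big1 => [|l /andP[li lj]].
    by rewrite /m eqxx (eq_sym j) (negbTE ij) eqxx addr0 addNr.
  by rewrite /m (negbTE li) (negbTE lj).
have := fs m (embH p) m0.
have -> : (fun l => embH p l + (m l)%:~R) = permpt (embH p) (tperm i j).
  apply/funext => l; rewrite /permpt /m.
  case: tpermP => [->|->|/eqP/negbTE -> /eqP/negbTE ->]; last by rewrite addr0.
    by rewrite eqxx intrN -pz; ring.
  by rewrite eq_sym (negbTE ij) eqxx -pz; ring.
rewrite fa odd_tperm ij expr1 mulN1r => /eqP.
by rewrite eq_sym -addr_eq0 -mulr2n mulrn_eq0 /= => /eqP.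
Qed.

Lemma natvecE b : exists2 m : ivec, \sum_(i < 4) m i = 0 &
  forall p : T3, embH (p + natvec R b) = fun i => embH p i + (m i)%:~R.
Proof.
exists (fun i => match val i with 0 => b.1.1%:Z | 1 => b.1.2%:Z | 2 => b.2%:Z
   | _ => - (b.1.1%:Z + b.1.2%:Z + b.2%:Z) end).
  by rewrite sum4E /=; ring.
move=> p; apply/funext => i; rewrite embHD; congr (_ + _); move: i; apply: ord4P;
  by rewrite /embH /natvec /= ?intrN ?intrD -?pmulrn.
Qed.

Section Product.
Variables f g : pt4 R -> R[i].
Hypotheses (hf : TSn_alternating f) (hg : TSn_alternating g).
Let F (p : T3) := f (embH p) * (g (embH p))^*.

Lemma product_shift b p : F (p + natvec R b) = F p.
Proof.
by rewrite /F; have [m m0 ->] := natvecE b; rewrite hf.1 ?hg.1.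
Qed.

Lemma product_act s p : F (actS s p) = F p.
Proof.
rewrite /F embH_act hf.2 hg.2 rmorphM rmorphXn rmorphN rmorph1 mulrACA -expr2 sqrr_sign.
by rewrite mul1r.
Qed.

Lemma product_walls p : @walls R p -> F p = 0.
Proof. by move=> hp; rewrite /F alternating_walls // mul0r. Qed.

End Product.

(** * Exactness of the lattice rule on the cube *)

(** The cube has volume 1 in the chart and contains 4 n^3 lattice points. [cbmeas] is kept along
    with the equation, for linearity of the integral. *)
Definition quadrature_exact (F : T3 -> R[i]) := cbmeas F /\
  dsum n (@cubeQ R) F = cint (@cubeQ R) F *+ (4 * n ^ 3).

Lemma dsum_cubeQD F G : dsum n (@cubeQ R) (fun p => F p + G p) =
  dsum n (@cubeQ R) F + dsum n (@cubeQ R) G.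
Proof.
rewrite !dsum_cubeQ // -big_split; apply: eq_bigr => s _.
rewrite -big_split; apply: eq_bigr => a _; rewrite -big_split; apply: eq_bigr => b _.
by rewrite -big_split.
Qed.

Lemma dsum_cubeQZ c F : dsum n (@cubeQ R) (fun p => c * F p) = c * dsum n (@cubeQ R) F.
Proof.
rewrite !dsum_cubeQ // mulr_sumr; apply: eq_bigr => s _.
rewrite mulr_sumr; apply: eq_bigr => a _; rewrite mulr_sumr; apply: eq_bigr => b _.
by rewrite mulr_sumr.
Qed.

Lemma quadrature_exactZ c F : quadrature_exact F -> quadrature_exact (fun p => c * F p).
Proof.
move=> [mF eF]; split; first exact: cbmeasZ.
by rewrite dsum_cubeQZ eF cintZ ?mulrnAr //; exact: boxm_cubeQ.
Qed.

Lemma quadrature_exact_sum (I : Type) (r : seq I) (P : pred I) (F : I -> T3 -> R[i]) :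
  (forall i, P i -> quadrature_exact (F i)) ->
  quadrature_exact (fun p => \sum_(i <- r | P i) F i p).
Proof.
move=> hF; elim: r => [|i r IH].
  (* The empty sum is written as a multiple of an exponential, for which both sides are computed. *)
  rewrite (_ : (fun p => _) = fun p => 0 * expi (lin3 0 0 0 p)).
    apply: quadrature_exactZ; split; first exact: cbmeas_expi.
    by rewrite dsum_expi // cint_expi !dvdz0.
  by apply/funext => p; rewrite big_nil mul0r.
rewrite (_ : (fun p => _) = fun p => (if P i then F i p else 0) + \sum_(i <- r | P i) F i p).
  have [Pi|_] := boolP (P i); last by under eq_fun do rewrite add0r.
  have [[mF eF] [mG eG]] := (hF i Pi, IH).
  split; first exact: cbmeasD.
  by rewrite dsum_cubeQD eF eG cintD -?mulrnDl //; exact: boxm_cubeQ.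
by apply/funext => p; rewrite big_cons; case: ifP => //; rewrite add0r.
Qed.

(** As t has zero sum, k_4 may be subtracted from every entry of [k]; the new entries are multiples
    of 4, which turns pi/2 into 2 pi. *)
Lemma phi_embH (k : ivec) (p : T3) : inH k -> phi k (embH p) =
  expi (lin3 ((k o1 - k o4) %/ 4)%Z ((k o2 - k o4) %/ 4)%Z ((k o3 - k o4) %/ 4)%Z p).
Proof.
move=> /inHP[_ hk]; rewrite /phi; congr expi.
pose c i := ((k i - k o4) %/ 4)%Z.
have cE i : k i = 4 * c i + k o4 by rewrite /c mulrC divzK ?hk // subrK.
rewrite -/(c o1) -/(c o2) -/(c o3) /lin3 /dotk sum4E (cE o1) (cE o2) (cE o3).
by rewrite !intrD !intrM /embH /=; field.
Qed.

Lemma phi_perm (k : ivec) (t : pt4 R) s :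
  phi k (permpt t s) = phi (fun i => k (s^-1%g i)) t.
Proof.
rewrite /phi /dotk; congr (expi (_ * _)).
rewrite [RHS](reindex_inj (@perm_inj _ s)) /=; apply: eq_bigr => i _.
by rewrite permK.
Qed.

Lemma inH_perm (k : ivec) (s : 'S_4) : inH k -> inH (fun i => k (s i)).
Proof.
move=> /inHP[k0 hk]; apply/inHP; split => [|i j]; last exact: hk.
by rewrite -[RHS]k0 [RHS](reindex_inj (@perm_inj _ s)).
Qed.

(** The product is one exponential, of frequency m = k.s - l.u. What has to be excluded is aliasing:
    a nonzero m whose lattice sum does not vanish. *)
Lemma quadrature_exact_phi (k l : ivec) s u : inLambda n k -> inLambda n l ->
  quadrature_exact (fun p => phi k (permpt (embH p) s) * (phi l (permpt (embH p) u))^*).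
Proof.
move=> /and5P[hk k43 k32 k21 k14] /and5P[hl l43 l32 l21 l14].
pose m : ivec := fun i => k (s^-1%g i) - l (u^-1%g i).
have hm : inH m.
  have /inHP[k0 kd] := inH_perm s^-1 hk; have /inHP[l0 ld] := inH_perm u^-1 hl.
  apply/inHP; split; first by rewrite sumrB k0 l0.
  move=> i j; rewrite (_ : m i - m j = (k (s^-1%g i) - k (s^-1%g j)) -
    (l (u^-1%g i) - l (u^-1%g j))); first exact: rpredB.
  by rewrite /m; ring.
have spread (v : ivec) : v o4 < v o3 -> v o3 < v o2 -> v o2 < v o1 -> v o1 < v o4 + (4 * n)%:Z ->
    forall i j, v i - v j < (4 * n)%:Z.
  by move=> h1 h2 h3 h4; apply: ord4P; apply: ord4P; lia.
have mphi (p : T3) : phi k (permpt (embH p) s) * (phi l (permpt (embH p) u))^* = phi m (embH p).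
  rewrite !phi_perm /phi expi_conj -expiD -mulrN -mulrDr; congr (expi (_ * _)).
  rewrite /dotk -sumrN -big_split /=; apply: eq_bigr => i _.
  by rewrite /m intrB mulrBl.
rewrite (_ : (fun p => _) = fun p => expi (lin3 ((m o1 - m o4) %/ 4)%Z
    ((m o2 - m o4) %/ 4)%Z ((m o3 - m o4) %/ 4)%Z p)); last first.
  by apply/funext => p; rewrite mphi phi_embH.
split; first exact: cbmeas_expi.
rewrite dsum_expi // cint_expi; congr ((nat_of_bool _)%:R *+ _).
have /inHP[m0 md] := hm.
pose c i := ((m i - m o4) %/ 4)%Z.
have cE i : m i = 4 * c i + m o4 by rewrite /c mulrC divzK ?md // subrK.
rewrite -/(c o1) -/(c o2) -/(c o3).
apply/idP/idP => [/and4P[d1 d2 d3 d4]|/and3P[/eqP -> /eqP -> /eqP ->]]; last by rewrite !dvdz0.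
(* The zero sum of [m] solved for its last entry; thus the condition on the sum of the c_i says that
   4n divides m_4, and with it every m_i. *)
have m4 : m o4 = - (c o1 + c o2 + c o3).
  by move: m0; rewrite sum4E (cE o1) (cE o2) (cE o3); lia.
have dm i : ((4 * n)%N %| m i)%Z.
  rewrite cE m4 rpredD ?rpredN // PoszM dvdz_mul //.
  by move: i; apply: ord4P => //; rewrite /c subrr div0z.
have mE i : m i = (4 * n)%:Z * (m i %/ (4 * n)%N)%Z by rewrite mulrC divzK.
have N0 : 0 < (4 * n)%:Z by lia.
have q0 : forall i, (m i %/ (4 * n)%N)%Z = 0.
  apply: int4_eq0 => [|i j].
    apply: (@mulfI _ (4 * n)%:Z); first by rewrite gt_eqF.
    by rewrite mulr0 mulr_sumr -[RHS]m0; apply: eq_bigr => i _; rewrite -mE.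
  have hkij := spread k k43 k32 k21 k14 (s^-1%g i) (s^-1%g j).
  have hlji := spread l l43 l32 l21 l14 (u^-1%g j) (u^-1%g i).
  (* The entries of [k] and of [l] differ by less than 4n, hence those of [m] by less than 8n and
     the integer quotients by at most 1. *)
  have : m i - m j < (4 * n)%:Z * 2 by rewrite /m; lia.
  by rewrite {1}(mE i) {1}(mE j) -mulrBr ltr_pM2l //; lia.
have mi0 i : m i = 0 by rewrite mE q0 mulr0.
by rewrite /c !mi0 subrr div0z eqxx.
Qed.

Lemma quadrature_exact_product f g : inTSn n f -> inTSn n g ->
  quadrature_exact (fun p => f (embH p) * (g (embH p))^*).
Proof.
move=> [r [/allP hr ->]] [q [/allP hq ->]].
(* The filters on membership record that the frequencies lie in Lambda_n, as needed for each
   term. *)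
rewrite (_ : (fun p => _) = fun p => \sum_(x <- r | x \in r) \sum_(y <- q | y \in q)
  \sum_(s : 'S_4) \sum_(u : 'S_4)
  (x.1 * (- (24%:R)^-1) * (-1) ^+ odd_perm s * (y.1 * (- (24%:R)^-1) * (-1) ^+ odd_perm u)^*) *
  (phi x.2 (permpt (embH p) s) * (phi y.2 (permpt (embH p) u))^*)).
  apply: quadrature_exact_sum => x /hr hx; apply: quadrature_exact_sum => y /hq hy.
  by apply: quadrature_exact_sum => s _; apply: quadrature_exact_sum => u _;
    apply: quadrature_exactZ; exact: quadrature_exact_phi.
apply/funext => p; rewrite -!big_seq rmorph_sum mulr_suml; apply: eq_bigr => x _.
rewrite -big_seq mulr_sumr; apply: eq_bigr => y _.
rewrite /TS !mulr_sumr rmorph_sum mulr_suml; apply: eq_bigr => s _.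
rewrite mulr_sumr; apply: eq_bigr => u _.
have assoc (a b c d : R[i]) : a * (b * (c * d)) = a * b * c * d by rewrite !mulrA.
by rewrite !assoc rmorphM mulrACA.
Qed.

(** For k in H, the point k/4n lies in the open alcove exactly when k is in Lambda_n. The enumerated
    box misses no such k, because coordinates in (-1, 1) give numerators strictly between -4n and
    4n. *)
Lemma simplex0_lattice_sum (F : pt4 R -> R[i]) :
  \sum_(j : {ffun 'I_4 -> 'I_(8 * n + 1)} | inLambda n (boxvec j))
    F (fun i => (boxvec j i)%:~R / (4 * n)%:R) = dsum n (@simplex0 R) (fun p => F (embH p)).
Proof.
have N0 : 0 < (4 * n)%:R :> R by rewrite ltr0n; lia.
pose h (j : {ffun 'I_4 -> 'I_(8 * n + 1)}) : T3 :=
  projH (fun i => (boxvec j i)%:~R / (4 * n)%:R).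
have hE j : inLambda n (boxvec j) -> embH (h j) = fun i => (boxvec j i)%:~R / (4 * n)%:R.
  move=> /and5P[/inHP[j0 _] _ _ _ _]; apply: embHK.
  by rewrite -mulr_suml -rmorph_sum j0 mul0r.
rewrite -(fsbig_pred (fun j => inLambda n (boxvec j))
  (fun j => F (fun i => (boxvec j i)%:~R / (4 * n)%:R))).
rewrite /dsum (@reindex_fsbig _ _ _ _ _ h [set` (fun j => inLambda n (boxvec j))]).
  by apply: eq_fsbigr => j; rewrite inE => hj; rewrite hE.
split.
- move=> j /= hj; have /and5P[hH j43 j32 j21 j14] := hj; split; last first.
    by exists (boxvec j); split => // i; rewrite hE.
  rewrite /simplex0 /= hE // !ltr_pM2r ?invr_gt0 // !ltr_int; split => //.
  rewrite ltr_pdivrMr // mulrDl mul1r divfK ?gt_eqF //.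
  by move: j14; rewrite -(ltr_int R) intrD -pmulrn.
- move=> j j'; rewrite !inE => hj hj' hh.
  have := hE j hj; rewrite hh (hE j' hj') => e.
  apply/ffunP => i; apply: val_inj; have := congr1 (fun t => t i) e => /=.
  move=> /(mulIf (invr_neq0 (lt0r_neq0 N0)))/eqP; rewrite eqr_int /boxvec => /eqP; lia.
- move=> p [Dp [k [hk pk]]].
  have kN i : - (4 * n)%:Z < k i < (4 * n)%:Z.
    have := cell_coord i (simplex0_sub_cell Dp).
    rewrite pk ltr_pdivrMr // ltr_pdivlMr // mul1r mulN1r.
    by rewrite -!(ltr_int R) intrN -!pmulrn.
  have kj i : (`|(k i + (4 * n)%:Z)%R|%N < 8 * n + 1)%N.
    by move: (k i) (kN i) => x; lia.
  have jE : boxvec [ffun i => Ordinal (kj i)] = k.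
    apply/funext => i; rewrite /boxvec ffunE /=.
    by move: (k i) (kN i) => x; lia.
  exists [ffun i => Ordinal (kj i)].
    suff : inLambda n (boxvec [ffun i => Ordinal (kj i)]) by [].
    rewrite jE; move: Dp; rewrite /simplex0 /= !pk !ltr_pM2r ?invr_gt0 //.
    move=> [D1 D2 D3 D4]; rewrite !ltr_int in D1 D2 D3.
    apply/and5P; split => //; move: D4.
    rewrite ltr_pdivrMr // mulrDl mul1r divfK ?gt_eqF //.
    by rewrite -(ltr_int R) intrD -pmulrn.
  rewrite /h jE -[RHS]projHK; congr projH; apply/funext => i; by rewrite pk.
Qed.

(** * The closed triangle, its volume and the normalisation *)

Lemma measurable_triH : measurable (@triH R).
Proof.
pose S i j := [set p : T3 | 0 <= embH p i - embH p j] `&`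
  [set p : T3 | embH p i - embH p j <= 1].
have mS i j : measurable (S i j).
  by apply: measurableI; apply: measurable_ler => //; apply: measurable_funB;
    exact: measurable_coord.
rewrite (_ : @triH R = S o1 o2 `&` S o2 o3 `&` S o3 o4 `&` S o1 o4).
  by do 3 (apply: measurableI; last exact: mS); exact: mS.
apply/seteqP; split => p; rewrite /triH /S /=.
  by move=> [/andP[? ?] /andP[? ?] /andP[? ?] /andP[? ?]].
by move=> [[[[? ?] [? ?]] [? ?]] [? ?]]; split; apply/andP.
Qed.

(** A point of the closed triangle outside the open one has two equal neighbouring coordinates or t1
    - t4 = 1, so it lies on a wall. *)
Lemma cint_triH F : cbmeas F -> cint (@triH R) F = cint (@simplex0 R) F.
Proof.
move=> hF.
have bT : boxm (@triH R).
  split; first exact: measurable_triH.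
  by move=> p; rewrite /triH /embH /box /= => -[h1 h2 h3 h4]; split; lra.
have bC : boxm (@triH R `\` @simplex0 R).
  rewrite setDE; apply: boxmI => //; apply: measurableC; exact: measurable_simplex0.
have -> : @triH R = @simplex0 R `|` (@triH R `\` @simplex0 R).
  rewrite setDUK // => p; rewrite /triH /simplex0 /= => -[h1 h2 h3 h4].
  by split; lra.
rewrite cintU //; [|exact: boxm_simplex0|by rewrite setDIK].
rewrite [X in _ + X]cint_walls ?addr0 // => p [].
rewrite /triH /= => -[h1 h2 h3 h4] nD; apply: contrapT => nw; apply: nD.
have nz i j (z : int) : i != j -> embH p i - embH p j != z%:~R.
  by move=> ij; apply/eqP => e; apply: nw; exists i, j; split => //; exists z.
have := nz o1 o2 0 isT; have := nz o2 o3 0 isT; have := nz o3 o4 0 isT.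
have := nz o1 o4 1 isT; rewrite /simplex0 /= => n1 n2 n3 n4; split.
- by rewrite lt_neqAle -subr_ge0 eq_sym -subr_eq0 n4; lra.
- by rewrite lt_neqAle -subr_ge0 eq_sym -subr_eq0 n3; lra.
- by rewrite lt_neqAle -subr_ge0 eq_sym -subr_eq0 n2; lra.
- have : embH p o1 - embH p o4 < 1 by rewrite lt_neqAle n1; lra.
  lra.
Qed.

(** Folding the constant 1, the exponential of frequency zero, over the cube of volume 1. *)
Lemma cint_simplex0_1 : cint (@simplex0 R) (fun=> 1) = 24%:R^-1.
Proof.
have lin0 : (fun p => expi (lin3 0 0 0 p)) = (fun=> 1) :> (T3 -> R[i]).
  by apply/funext => p; rewrite /lin3 !mulr0 !mul0r !addr0 expi0.
have m1 : cbmeas (fun _ : T3 => 1 : R[i]) by rewrite -lin0; exact: cbmeas_expi.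
have := cint_folding m1 (fun _ _ => erefl) (fun _ _ => erefl).
rewrite -{1}lin0 cint_expi /= => /esym e; apply: (mulIf (x := 24%:R)).
  by rewrite pnatr_eq0.
by rewrite mulr_natr e mulVf // pnatr_eq0.
Qed.

(** Folding both sides of the exact rule on the cube leaves the factor 4 n^3 on the alcove;
    multiplied by 6 / n^3 it gives 24, the inverse of the volume of the triangle in the chart. *)
Lemma disc_ip_cont_ip (f g : pt4 R -> R[i]) :
  inTSn n f -> inTSn n g -> disc_ip n f g = cont_ip f g.
Proof.
move=> hf hg; pose F (p : T3) := f (embH p) * (g (embH p))^*.
have af := inTSn_alternating hf; have ag := inTSn_alternating hg.
have [mF eF] := quadrature_exact_product hf hg; rewrite -/F in mF eF.
have cF := cint_folding mF (product_shift af ag) (product_act af ag).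
have dF := dsum_folding n_gt0 (product_shift af ag) (product_act af ag) (product_walls g af).
have m1 : cbmeas (fun _ : T3 => 1 : R[i]).
  rewrite (_ : (fun=> 1) = fun p => expi (lin3 0 0 0 p)); first exact: cbmeas_expi.
  by apply/funext => p; rewrite /lin3 !mulr0 !mul0r !addr0 expi0.
have nC : (n%:R : R[i]) != 0 by rewrite pnatr_eq0 -lt0n.
have -> : cont_ip f g = cint (@simplex0 R) F * 24%:R.
  rewrite -(cint_triH mF) -[24%:R]invrK -cint_simplex0_1 -(cint_triH m1).
  rewrite /cont_ip /cint /=; congr (_ / Complex _ _).
  by rewrite /Rintegral integral0.
rewrite /disc_ip (simplex0_lattice_sum (fun t => f t * (g t)^*)) -/F.
have e24 : dsum n (@simplex0 R) F = cint (@simplex0 R) F * (4 * n ^ 3)%:R.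
  apply: (mulIf (x := 24%:R)); first by rewrite pnatr_eq0.
  by rewrite !mulr_natr -dF eF cF mulrnAC.
by rewrite e24 natrM natrX; field.
Qed.

End Quadrature.

Theorem theorem4p5 (R : realType) (n : nat) (hn : (1 <= n)%N)
  (f g : pt4 R -> R[i]) :
  inTSn n f -> inTSn n g -> disc_ip n f g = cont_ip f g.
Proof. exact: disc_ip_cont_ip. Qed.
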